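(* There exists a function $f:\mathbb{N}\to\mathbb{N}$ such that the following holds. Let $m$ be a positive integer and let $G$ be a profinite group such that there are $m$ procyclic subgroups of $G$ whose union contains all commutators $[x,y]$ with $x,y\in G$. Then $G$ possesses a finite characteristic subgroup $M$ contained in $G'$ such that $|M|\le f(m)$ and $G'/M$ is procyclic.
   Context: For profinite groups all the usual group-theoretic concepts are interpreted topologically: subgroups are closed, a characteristic subgroup is a closed subgroup invariant under all continuous automorphisms, and $G'$ denotes the closed subgroup of $G$ generated by all commutators $[x,y]$, $x,y\in G$. A procyclic group is a profinite group that is topologically generated by one element (equivalently, an inverse limit of finite cyclic groups). *)

(* Defs.v *)
From HB Require Import structures.
From mathcomp Require Import all_boot all_classical.
From mathcomp Require Import topology.

Set Implicit Arguments.
Unset Strict Implicit.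
Unset Printing Implicit Defensive.

Local Open Scope classical_set_scope.
Local Open Scope group_scope.
Local Open Scope quotient_scope.

HB.mixin Record isTopologicalGroup G & Topological G & Group G := {
  mulg_continuous : continuous (fun x : G * G => x.1 * x.2);
  invg_continuous : continuous (fun x : G => x^-1)
}.

#[short(type="topGroupType")]
HB.structure Definition TopologicalGroup :=
  {G of Topological G & Group G & isTopologicalGroup G}.

Definition subgroup (G : groupType) (H : set G) : Prop :=
  [/\ H 1, forall x y, H x -> H y -> H (x * y) & forall x, H x -> H x^-1].

Record normalSubgroup (G : groupType) := NormalSubgroup {
  nsub_set :> set G;
  nsub_subgroup : subgroup nsub_set;
  nsub_normal : forall x y : G, nsub_set x -> nsub_set (x ^ y)
}.

Section Quotient.
Variables (G : topGroupType) (N : normalSubgroup G).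

Definition coset_rel (x y : G) : bool := `[< nsub_set N (x^-1 * y) >].

Lemma coset_rel_equiv : equiv_class_of coset_rel.
Proof.
have [N1 NM NV] := nsub_subgroup N.
split=> [x|x y|y x z]; rewrite /coset_rel.
- by apply/asboolP; rewrite mulVg.
- by apply/asboolP/asboolP => /NV; rewrite invgM invgK.
- move=> /asboolP Nxy /asboolP Nyz; apply/asboolP.
  by have := NM _ _ Nxy Nyz; rewrite mulgA mulgK.
Qed.

Canonical coset_equiv_rel := EquivRelPack coset_rel_equiv.

Definition quotient_group : Type := quotient_topology {eq_quot coset_rel}.

HB.instance Definition _ := Topological.on quotient_group.
HB.instance Definition _ := Quotient.on quotient_group.

Definition quo : G -> quotient_group := \pi_quotient_group.

Definition quo_one : quotient_group := quo 1.
Definition quo_mul (a b : quotient_group) : quotient_group :=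
  quo (repr a * repr b).
Definition quo_inv (a : quotient_group) : quotient_group := quo (repr a)^-1.

Lemma quoP x y : quo x = quo y <-> nsub_set N (x^-1 * y).
Proof.
split=> [/(@eqmodP _ coset_equiv_rel)/asboolP //|Nxy].
exact/(@eqmodP _ coset_equiv_rel)/asboolP.
Qed.

Lemma quo_reprK : cancel repr quo.
Proof. exact: reprK. Qed.

Lemma quo_morphM x y : quo (x * y) = quo_mul (quo x) (quo y).
Proof.
have [N1 NM NV] := nsub_subgroup N.
have /quoP Nx : quo x = quo (repr (quo x)) by rewrite quo_reprK.
have /quoP Ny : quo y = quo (repr (quo y)) by rewrite quo_reprK.
move: Nx Ny; set x' := repr _; set y' := repr _ => Nx Ny; apply/quoP.
have -> : (x * y)^-1 * (x' * y') = (x^-1 * x') ^ y * (y^-1 * y').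
  by rewrite /conjg invgM !mulgA mulgK.
by apply: NM => //; exact: nsub_normal.
Qed.

Lemma quo_morphV x : quo x^-1 = quo_inv (quo x).
Proof.
have [N1 NM NV] := nsub_subgroup N.
have /quoP Nx : quo x = quo (repr (quo x)) by rewrite quo_reprK.
move: Nx; set x' := repr _ => Nx; apply/quoP.
have -> : (x^-1)^-1 * x'^-1 = ((x^-1 * x')^-1) ^ x^-1.
  by rewrite /conjg invgM !invgK -!mulgA mulgV mulg1.
by apply: nsub_normal; exact: NV.
Qed.

Lemma quo_mulA : associative quo_mul.
Proof.
move=> a b c; rewrite -[a]quo_reprK -[b]quo_reprK -[c]quo_reprK.
by rewrite -!quo_morphM mulgA.
Qed.

Lemma quo_mul1 : left_id quo_one quo_mul.
Proof. by move=> a; rewrite -[a]quo_reprK -quo_morphM mul1g. Qed.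

Lemma quo_mulr1 : right_id quo_one quo_mul.
Proof. by move=> a; rewrite -[a]quo_reprK -quo_morphM mulg1. Qed.

Lemma quo_mulV : left_inverse quo_one quo_inv quo_mul.
Proof.
by move=> a; rewrite -[a]quo_reprK -quo_morphV -quo_morphM mulVg.
Qed.

Lemma quo_mulrV : right_inverse quo_one quo_inv quo_mul.
Proof.
by move=> a; rewrite -[a]quo_reprK -quo_morphV -quo_morphM mulgV.
Qed.

HB.instance Definition _ := isGroup.Build quotient_group
  quo_mulA quo_mul1 quo_mulr1 quo_mulV quo_mulrV.

Lemma quo_continuous : continuous quo.
Proof. exact: pi_continuous. Qed.

Lemma quo_open (U : set G) : open U -> open (quo @` U).
Proof.
move=> oU; have [N1 NM NV] := nsub_subgroup N.
rewrite /open /= /quotient_open.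
have -> : \pi_quotient_group @^-1` (quo @` U) =
    \bigcup_(n in N) ((fun x : G => x * n) @^-1` U).
  apply/seteqP; split => [x [u Uu /esym/quoP Nxu]|x [n Nn Uxn]] /=.
    by exists (x^-1 * u) => //=; rewrite mulVKg.
  exists (x * n) => //; apply/esym/quoP.
  by rewrite mulKg.
apply: bigcup_open => n _; apply: open_comp => // x _.
apply: (@continuous_comp _ _ _ (fun x : G => (x, n))
  (fun p : G * G => p.1 * p.2)); last exact: mulg_continuous.
by apply: cvg_pair; [exact: cvg_id | exact: cvg_cst].
Qed.

Lemma quo_nbhs (x : G) (U : set G) : nbhs x U -> nbhs (quo x) (quo @` U).
Proof.
rewrite nbhsE => -[V [oV Vx] VU]; rewrite nbhsE; exists (quo @` V).
  by split; [exact: quo_open | exists x].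
exact: image_subset.
Qed.

Lemma quo_mul_continuous :
  continuous (fun p : quotient_group * quotient_group => p.1 * p.2).
Proof.
move=> [a b] W /=; rewrite -[a]quo_reprK -[b]quo_reprK.
set x := repr a; set y := repr b.
rewrite -[quo x * quo y]/(quo_mul (quo x) (quo y)) -quo_morphM.
move=> /quo_continuous Wxy.
have [[A B] /= [nA nB] AB] := @mulg_continuous G (x, y) _ Wxy.
exists (quo @` A, quo @` B) => /=; first by split; exact: quo_nbhs.
move=> [_ _] /= [[u Au <-] [v Bv <-]].
by rewrite -[_ * _]/(quo_mul (quo u) (quo v)) -quo_morphM; exact: (AB (u, v)).
Qed.

Lemma quo_inv_continuous : continuous (fun a : quotient_group => a^-1).
Proof.
move=> a W; rewrite -[a]quo_reprK; set x := repr a.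
rewrite -[(quo x)^-1]/(quo_inv (quo x)) -quo_morphV.
move=> /quo_continuous Wx.
have /quo_nbhs := @invg_continuous G x _ Wx.
apply: filterS => _ [u /= Wu <-].
by rewrite -[(quo u)^-1]/(quo_inv (quo u)) -quo_morphV.
Qed.

HB.instance Definition _ := isTopologicalGroup.Build quotient_group
  quo_mul_continuous quo_inv_continuous.

End Quotient.

Section ProfiniteGroups.
Variable G : topGroupType.
Implicit Types (H A : set G).

Definition closed_subgroup H : Prop := subgroup H /\ closed H.

Definition top_generated A : set G := smallest closed_subgroup A.

Definition commutators : set G := [set z | exists x y : G, z = [~ x, y]].

Definition derived_subgroup : set G := top_generated commutators.

(* Groups are handled as subgroups of an ambient topological group, with the
   induced topology; the ambient group itself is [set: G]. *)
Definition profinite H : Prop :=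
  [/\ subgroup H, compact H, hausdorff_space (set_type H)
    & totally_disconnected H].

Definition procyclic H : Prop :=
  profinite H /\ exists g : G, H = top_generated [set g].

Definition continuous_automorphism (phi : G -> G) : Prop :=
  [/\ bijective phi, {morph phi : x y / x * y} & continuous phi].

Definition characteristic H : Prop :=
  closed_subgroup H /\
  forall phi : G -> G, continuous_automorphism phi -> phi @` H = H.

End ProfiniteGroups.

(* H / N as a subgroup of G / N; the topology induced from G / N agrees with
   the quotient topology of H when N `<=` H, because quo N is open. *)
Definition quotient_subgroup (G : topGroupType) (H : set G)
    (N : normalSubgroup G) : set (quotient_group N) :=
  quo N @` H.
Arguments derived_subgroup : clear implicits.
Arguments quotient_subgroup [G] H N.

(* Main.v *)
(** Write nu = m!, n = nu^2 and D = G'.  Suppose first that G is finite.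
    If B is an abelian subgroup and a coset zB consists of commutators, then by
    the pigeonhole principle one of the m cyclic subgroups contains b^nu for all
    b in B.  For an abelian normal subgroup A the commutators [ag, bh] with
    a, b in A form such a coset; hence [A, G]^nu is cyclic and is therefore
    centralised by D.  Combining this with the cosets {[av, b] : v in D} and
    with the bilinearity of commutators modulo [D, G], one finds that the n-th
    powers of D/D' form a cyclic group.  Next, each commutator generates a
    subgroup with at most m conjugates, so nu-th powers lie in the intersection
    N of the normalisers of these subgroups, while [N, N] centralises D; with
    Schur's theorem this bounds |D'|.  Since D/D' has at most n^(mn) elements
    of order dividing n, the subgroup M of the x in D with x^n in D' has
    m-bounded order, and D/M is cyclic.
    For profinite G, take for M the intersection of the preimages of the
    corresponding subgroups of all finite quotients; a generator of D modulo M
    is obtained by compactness. *)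
From HB Require Import structures.
From mathcomp Require Import all_boot all_fingroup all_solvable.
From mathcomp Require Import ssralg finalg.

Set Implicit Arguments.
Unset Strict Implicit.
Unset Printing Implicit Defensive.

Local Open Scope group_scope.

Definition comm_cover (m : nat) (gT : finGroupType) (G : {set gT})
    (c : 'I_m -> gT) : Prop :=
  (forall i, c i \in G) /\
  {in G &, forall x y, exists i, [~ x, y] \in <[c i]>}.

(** For p-elements this amounts to lying in a common cyclic subgroup, because the subgroups of a
    cyclic p-group form a chain. *)
Definition nested (gT : finGroupType) (x y : gT) : bool :=
  (x \in <[y]>) || (y \in <[x]>).

(** * Commutators in finite groups *)

Section Elementary.
Variable gT : finGroupType.
Implicit Types (G H K A B : {group gT}) (x y z : gT) (p : nat).

Lemma expg_fact_in K x r m :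
  0 < r <= m -> x ^+ r \in K -> x ^+ m`! \in K.
Proof.
by move=> /dvdn_fact/dvdnP[q ->] Kxr; rewrite mulnC expgM groupX.
Qed.

Lemma nested_sym x y : nested x y = nested y x.
Proof. by rewrite /nested orbC. Qed.

Lemma nestedVl x y : nested x^-1 y = nested x y.
Proof. by rewrite /nested groupV cycleV. Qed.

Lemma nested_cycle p z x y :
  p.-elt x -> p.-elt y -> x \in <[z]> -> y \in <[z]> -> nested x y.
Proof.
move=> px py zx zy; rewrite /nested -!cycle_subG.
have zxS : <[x]> \subset <[z]> by rewrite cycle_subG.
have zyS : <[y]> \subset <[z]> by rewrite cycle_subG.
rewrite -(cardSg_cyclic (cycle_cyclic z) zxS zyS).
rewrite -(cardSg_cyclic (cycle_cyclic z) zyS zxS).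
have [[i oi] [j oj]] := (p_natP px, p_natP py).
rewrite -!orderE oi oj.
by case/orP: (leq_total i j) => /(dvdn_exp2l p) ->; rewrite ?orbT.
Qed.

Lemma p_eltX_nested p x y n :
  p.-elt x -> p.-elt y -> nested x y -> nested (x ^+ n) y.
Proof.
move=> px py /orP[xy|yx].
  by rewrite /nested groupX.
by apply: (@nested_cycle p x); rewrite ?p_eltX ?mem_cycle.
Qed.

Lemma nested_maxP x y : nested x y -> #[x] <= #[y] -> x \in <[y]>.
Proof.
case/orP=> // yx leo; suff /eqP -> : <[y]> == <[x]> by apply: cycle_id.
by rewrite eqEcard cycle_subG yx -!orderE.
Qed.

(** Write y = x^i. If p divides i, then y is a power of x^p; otherwise i is prime to the order of x
    and y generates [<[x]>]. *)
Lemma cycle_sub_or_gen p x y :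
  prime p -> p.-elt x -> y \in <[x]> -> (x \in <[y]>) || (y \in <[x ^+ p]>).
Proof.
move=> p_pr px /cycleP[i ->]; case: (boolP (p %| i)) => [/dvdnP[j ->]|pi].
  by rewrite mulnC expgM mem_cycle orbT.
have : generator <[x]> (x ^+ i).
  rewrite generator_coprime; have [k ->] := p_natP px.
  by rewrite coprimeXl // prime_coprime.
by rewrite /generator => /eqP <-; rewrite cycle_id.
Qed.

Lemma gen_mul_Xp p x y :
  prime p -> p.-elt x -> y \in <[x ^+ p]> -> x \in <[x * y]>.
Proof.
move=> p_pr px /cycleP[j ->]; rewrite -expgM -{2}[x]expg1 -expgD.
have : generator <[x]> (x ^+ (1 + p * j)).
  rewrite generator_coprime; have [k ->] := p_natP px.
  by rewrite coprimeXl // prime_coprime // dvdn_addl ?dvdn_mulr // dvdn1;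
     case: eqP p_pr => // ->.
by rewrite /generator => /eqP <-; rewrite cycle_id.
Qed.

(** Pigeonhole: some [<[c i]>] meets the coset z B in at least |B| / m elements. Their quotients lie
    in the intersection of B and [<[c i]>], whose index in B is therefore at most m and so divides
    m!. One translate z b in [<[c i]>] is kept, as it gives access to powers of z itself. *)
Lemma cover_exp m (c : 'I_m -> gT) B z :
    abelian B -> (forall b, b \in B -> exists i, z * b \in <[c i]>) ->
  exists i, (exists2 b, b \in B & z * b \in <[c i]>) /\
            {in B, forall b, b ^+ m`! \in <[c i]>}.
Proof.
move=> abB cov.
pose Bi i := [set b in B | z * b \in <[c i]>].
have m_gt0 : 0 < m.
  by have [[j jm] _] := cov 1 (group1 B); apply: leq_ltn_trans jm.
have leB : #|B| <= \sum_(i < m) #|Bi i|.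
  have cBi i : #|Bi i| = \sum_(b in B) (z * b \in <[c i]>)%g.
    rewrite -sum1_card [RHS](bigID (fun b => z * b \in <[c i]>)) /=.
    rewrite [X in _ + X]big1 ?addn0 => [|b /andP[_ /negbTE->] //].
    by apply: eq_big => b; rewrite ?inE // => /andP[_ ->].
  under eq_bigr do rewrite cBi.
  rewrite exchange_big -sum1_card /= leq_sum // => b /cov[i Ci].
  by rewrite (bigD1 i) //= Ci leq_addr.
have [i _ maxi] := @arg_maxnP 'I_m (Ordinal m_gt0) xpredT (fun i => #|Bi i|) isT.
have {leB} leB : #|B| <= m * #|Bi i|.
  apply: leq_trans leB _; rewrite -[X in (X * _)%N]card_ord -sum_nat_const.
  by apply: leq_sum => j _; apply: maxi.
have [b0] : exists b0, b0 \in Bi i.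
  apply/set0Pn; rewrite -card_gt0; have := leq_trans (cardG_gt0 B) leB.
  by rewrite muln_gt0 => /andP[].
rewrite inE => /andP[Bb0 Cb0]; exists i; split; first by exists b0.
pose D := (B :&: <[c i]>)%G.
have sub : [set b0^-1 * b | b in Bi i] \subset D.
  apply/subsetP=> _ /imsetP[b + ->]; rewrite inE => /andP[Bb Cb].
  rewrite inE groupM ?groupV //=.
  have -> : b0^-1 * b = (z * b0)^-1 * (z * b).
    by rewrite invMg -!mulgA mulKg.
  by rewrite groupM ?groupV.
have leD : #|Bi i| <= #|D|.
  by rewrite -(card_imset (Bi i) (mulgI b0^-1)) subset_leq_card.
have DB : D \subset B by apply: subsetIl.
have idx : 0 < #|B : D| <= m.
  rewrite indexg_gt0 -(leq_pmul2l (cardG_gt0 D)) Lagrange //.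
  by apply: leq_trans leB _; rewrite mulnC leq_mul2r leD orbT.
move=> b Bb; apply: (expg_fact_in (K := <[c i]>%G) idx).
have nDB : B \subset 'N(D) by apply: sub_abelian_norm.
suff : b ^+ #|B : D| \in D by rewrite inE => /andP[].
apply: coset_idr; first by rewrite groupX // (subsetP nDB).
rewrite morphX ?(subsetP nDB) // -card_quotient // expg_cardG //.
by rewrite mem_quotient.
Qed.

(** Two of the m + 1 conjugates of x by g^0, ..., g^m lie in the same [<[c i]>]. Having equal
    orders, they generate the same subgroup, so some g^r with 0 < r <= m normalises [<[x]>]. *)
Lemma normX_cycle m (c : 'I_m -> gT) G x g :
    (forall h, h \in G -> exists i, x ^ h \in <[c i]>) -> g \in G ->
  g ^+ m`! \in 'N(<[x]>).
Proof.
move=> cov Gg.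
pose f (j : 'I_m.+1) : 'I_m := xchoose (cov (g ^+ j) (groupX j Gg)).
have /injectivePn[j [k neq_jk fjk]] : ~~ injectiveb f.
  apply: contraL (ltnSn m) => /injectiveP injf; rewrite -leqNgt.
  by have := leq_card f injf; rewrite !card_ord.
have key (i k' : 'I_m.+1) : f i = f k' -> i < k' -> g ^+ m`! \in 'N(<[x]>).
  move=> fik ltik; apply: (@expg_fact_in 'N(<[x]>)%G _ (k' - i)).
    by rewrite subn_gt0 ltik (leq_trans (leq_subr _ _)) // -ltnS.
  have Ci := xchooseP (cov (g ^+ i) (groupX i Gg)).
  have Ck := xchooseP (cov (g ^+ k') (groupX k' Gg)).
  rewrite -/(f i) in Ci; rewrite -/(f k') -fik in Ck.
  have eqC : <[x ^ g ^+ i]> = <[x ^ g ^+ k']>.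
    apply/eqP; rewrite (eq_subG_cyclic (cycle_cyclic (c (f i)))) ?cycle_subG //.
    by rewrite -!orderE !orderJ.
  rewrite inE; apply/subsetP=> _ /imsetP[y xy ->].
  have : y ^ (g ^+ k') \in <[x ^ g ^+ i]>.
    by rewrite eqC cycleJ memJ_conjg.
  rewrite cycleJ -{1}(subnK (ltnW ltik)) expgD conjgM memJ_conjg //.
case: (ltngtP j k) neq_jk => [lt _|lt _|/val_inj-> /eqP //].
- exact: key lt.
- by apply: key lt.
Qed.

(** Automorphisms of a cyclic group are power maps, and these commute. *)
Lemma norm_cycle_commC x s t :
  s \in 'N(<[x]>) -> t \in 'N(<[x]>) -> [~ s, t] \in 'C[x].
Proof.
move=> /normP Ns /normP Nt.
have /cycleP[i xi] : x ^ s \in <[x]> by rewrite -Ns memJ_conjg cycle_id.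
have /cycleP[j xj] : x ^ t \in <[x]> by rewrite -Nt memJ_conjg cycle_id.
rewrite cent1C; apply/cent1P/commgP/conjg_fixP.
have E y : y \in <[x]> -> y ^ (s * t) = y ^ (t * s).
  case/cycleP=> k ->.
  by rewrite !conjgM !conjXg xi xj !conjXg xi xj -!expgM mulnCA.
have -> : [~ s, t] = (t * s)^-1 * (s * t) by rewrite invMg commgEl /conjg !mulgA.
by rewrite conjgM E ?conjgKV // -mem_conjg conjsgM Nt Ns cycle_id.
Qed.
End Elementary.

(** * Counting arguments, transfer and Schur's theorem *)

Section Counting.
Variable gT : finGroupType.
Implicit Types (G H K A B : {group gT}) (x y z : gT) (p : nat).

(** Each cyclic group [<[c i]>] has at most e elements of order dividing e. *)
Lemma card_commg_set_cover m (c : 'I_m -> gT) G e :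
  0 < e -> {in G &, forall x y, exists i, [~ x, y] \in <[c i]>} ->
  {in commg_set G G, forall x, x ^+ e = 1} ->
  #|commg_set G G| <= m * e.
Proof.
move=> e_gt0 cov Xe.
have cardL i : #|'Ldiv_e(<[c i]>)| <= e.
  pose L := Group (group_Ldiv e (cycle_abelian (c i))).
  have sL : L \subset <[c i]> by apply: subsetIl.
  have /cyclicP[y Ly] := cyclicS sL (cycle_cyclic _).
  rewrite -[#|_|]/#|L| Ly -orderE dvdn_leq // order_dvdn.
  suff /LdivP[_ ->] : y \in 'Ldiv_e(<[c i]>) by [].
  by rewrite -[_ :&: _]/(L : {set gT}) Ly cycle_id.
apply: (@leq_trans #|\bigcup_i 'Ldiv_e(<[c i]>)|).
  apply/subset_leq_card/subsetP=> x Xx; have xe := Xe x Xx.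
  case/imset2P: Xx xe => y z Gy Gz -> xe.
  have [i Ci] := cov y z Gy Gz.
  by apply/bigcupP; exists i => //; apply/LdivP.
rewrite -[X in (X * _)%N]card_ord -sum_nat_const.
elim/big_rec2: _ => [|i s B _ les]; first by rewrite cards0.
by rewrite (leq_trans (leq_card_setU _ _)) // leq_add.
Qed.

Lemma card_gen_abelian (S : {set gT}) e :
  abelian <<S>> -> {in S, forall x, x ^+ e = 1} -> 0 < e ->
  #|<<S>>| <= e ^ #|S|.
Proof.
move=> abS Se e_gt0.
suff gen (s : seq gT) : {subset s <= S} -> #|<<[set x in s]>>| <= e ^ size s.
  by have := gen (enum S); rewrite set_enum -cardE; apply=> x; rewrite mem_enum.
elim: s => [_|x s IHs /= sS].
  by rewrite (_ : [set _ in _] = set0) ?gen0 ?cards1 //; apply/setP=> z; rewrite !inE.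
have Sx : x \in S by rewrite sS ?mem_head.
have {IHs} /IHs IHs : {subset s <= S} by move=> z zs; rewrite sS ?inE ?zs ?orbT.
rewrite set_cons -joingE -joing_idl -joing_idr.
rewrite cent_joinEl.
  rewrite expnS; apply: (@leq_trans (#|<[x]>| * #|<<[set z in s]>>|)).
    by rewrite mul_cardG leq_pmulr.
  by rewrite leq_mul // -orderE dvdn_leq // order_dvdn Se.
apply: (sub_abelian_cent2 abS); first by rewrite cycle_subG mem_gen.
by apply: genS; apply/subsetP=> z; rewrite inE => zs; rewrite sS ?inE ?zs ?orbT.
Qed.

(** [phi] may vary within a coset of K: it is evaluated at one representative per coset, and the
    last hypothesis makes this injective. *)
Lemma index_leq_rep (T : finType) (phi : gT -> T) H K (B : {set T}) :
  K \subset H -> {in H, forall y, phi y \in B} ->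
  {in H &, forall y z, phi y = phi z -> y * z^-1 \in K} -> #|H : K| <= #|B|.
Proof.
move=> sKH phiB phiK; rewrite /indexg.
rewrite -(card_in_imset (f := fun A : {set gT} => phi (repr A))).
  apply/subset_leq_card/subsetP=> _ /imsetP[_ /rcosetsP[x Hx ->] ->].
  apply: phiB; have := mem_repr_rcoset K x; case/rcosetP=> k Kk ->.
  by rewrite groupM // (subsetP sKH).
have Hr x : x \in H -> repr (K :* x) \in H.
  move=> Hx; have := mem_repr_rcoset K x; case/rcosetP=> k Kk ->.
  by rewrite groupM // (subsetP sKH).
move=> _ _ /rcosetsP[x Hx ->] /rcosetsP[y Hy ->] /phiK.
rewrite -mem_rcoset => /(_ (Hr x Hx) (Hr y Hy)) /rcoset_eqP.
by rewrite !rcoset_repr => ->.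
Qed.

(** The transfer from K to its centre kills K', its target being abelian, and sends a central x to
    the power of x by the index of the centre. *)
Lemma center_der1_expg K x :
  x \in K^`(1) -> x \in 'Z(K) -> x ^+ #|K : 'Z(K)| = 1.
Proof.
move=> K'x Zx; have Kx := subsetP (der_sub 1 K) x K'x.
have abZ : abelian (idm 'Z(K) @* 'Z(K)) by rewrite morphim_idm // center_abelian.
pose t := transfer_morphism K abZ.
have : t x = 1.
  have t1 : (t @* K)^`(1) = 1 by apply/derG1P; exact: FinRing.zmod_abelian.
  by apply/set1gP; rewrite -t1 -morphim_der // mem_morphim.
have Zx' : x \in idm 'Z(K) @* 'Z(K) by rewrite morphim_idm.
rewrite /= /transfer.
rewrite (eq_bigr (fun=> FiniteModule.fmod abZ x)) => [|_ /rcosetsP[y Ky ->]].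
  rewrite GRing.sumr_const -FiniteModule.fmodX //.
  move/(congr1 (fun u => FiniteModule.fmval u)).
  by rewrite FiniteModule.fmodK ?groupX.
rewrite /restrm /=; congr (FiniteModule.fmod _ _).
have cx : {in K, forall u, x * u = u * x} by case/centerP: Zx.
have -> : 'Z(K) :* y :* x = 'Z(K) :* y.
  by rewrite -rcosetM -cx // rcosetM rcoset_id.
rewrite /idm -cx -?mulgA ?mulgV ?mulg1 //.
have := mem_repr_rcoset 'Z(K) y; case/rcosetP=> k Zk ->.
by rewrite groupM // (subsetP (center_sub K)).
Qed.

(** The exponent counts the Schreier elements, indexed by a coset, one of at most s * s commutators,
    and a coset. The last factor s counts the cosets of K' :&: 'Z(K) in K'. *)
Definition schur_bound s := (s ^ (s * (s * s) * s) * s)%N.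

(* Schur's theorem: by transfer K' :&: 'Z(K) has exponent dividing |K : 'Z(K)|, and
   it is generated by the Schreier elements built from the commutators. *)
Lemma card_der1_schur K s : #|K : 'Z(K)| <= s -> #|K^`(1)| <= schur_bound s.
Proof.
set Z := 'Z(K) => leKZ.
have s_gt0 : 0 < s by apply: leq_trans leKZ; rewrite indexg_gt0.
pose S := commg_set K K; pose L := K^`(1)%G; pose T := (L :&: Z)%G.
have sZK : Z \subset K := center_sub K.
have mem_rc (A B : {group gT}) x : x \in B -> A :* x \in rcosets A B.
  by move=> Bx; apply/rcosetsP; exists x.
have sLK : L \subset K := der_sub 1 K.
(* Central factors drop out of a commutator, so it depends only on the cosets of its entries modulo
   Z. *)
have cardS : #|S| <= s * s.
  pose B := [set [~ repr u.1, repr u.2] | u in setX (rcosets Z K) (rcosets Z K)].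
  apply: (@leq_trans #|B|); last first.
    by apply: leq_trans (leq_imset_card _ _) _; rewrite cardsX leq_mul.
  apply/subset_leq_card/subsetP=> _ /imset2P[x y Kx Ky ->].
  apply/imsetP; exists (Z :* x, Z :* y); first by rewrite inE /= !mem_rc.
  rewrite /=; case: repr_rcosetP => z /centerP[Kz cz].
  case: repr_rcosetP => t /centerP[Kt ct].
  have cent1 a b : a \in K -> (forall u, u \in K -> commute b u) -> [~ a, b] = 1.
    by move=> Ka cb; apply/eqP/commgP/commute_sym/cb.
  have cent2 a b : a \in K -> (forall u, u \in K -> commute b u) -> [~ b, a] = 1.
    by move=> Ka cb; apply/eqP/commgP/cb.
  rewrite commMgJ (cent2 _ z) ?groupM // conj1g mul1g.
  by rewrite commgMJ (cent1 _ t) // conj1g mulg1.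
have cardR : #|rcosets T L| <= s.
  apply: leq_trans leKZ; apply: (@index_leq_rep _ (fun y => Z :* y)).
  - exact: subsetIl.
  - by move=> y Ly; rewrite mem_rc // (subsetP sLK).
  move=> y z Ly Lz /rcoset_eqP; rewrite mem_rcoset => Zyz.
  by apply/setIP; split; rewrite // groupM ?groupV.
pose R := rcosets T L.
pose P := [set repr u.1.1 * u.1.2 * (repr u.2)^-1 | u in setX (setX R S) R].
pose T0 := generated_group (P :&: T).
have sT0T : T0 \subset T by rewrite gen_subG subsetIr.
have cardT0 : #|T0| <= s ^ (s * (s * s) * s).
  apply: (@leq_trans (#|K : Z| ^ #|P :&: T|)).
    apply: card_gen_abelian; last exact: indexg_gt0.
      by apply: abelianS (center_abelian K); rewrite (subset_trans sT0T) ?subsetIr.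
    by move=> x /setIP[_ /setIP[K'x Zx]]; apply: center_der1_expg.
  apply: (@leq_trans (s ^ #|P :&: T|)).
    by elim: #|_ :&: _| => // k IHk; rewrite !expnS leq_mul.
  rewrite leq_pexp2l // (leq_trans (subset_leq_card (subsetIl _ _))) //.
  by rewrite (leq_trans (leq_imset_card _ _)) // !cardsX !leq_mul.
have reprL (A : {set gT}) : A \in R -> repr A \in L.
  case/rcosetsP=> y Ly ->; case: repr_rcosetP => t /setIP[Lt _].
  exact: groupM.
(* Induction on word length: [repr A] times a commutator g is a Schreier element, which lies in T0,
   times the representative of the coset of [repr A * g]. *)
have sLT0 : L \subset T0 * [set repr A | A in R].
  apply/subsetP=> x /gen_prodgP[n [f Sf ->]]; elim: n f Sf => [|n IHn] f Sf.
    rewrite big_ord0; apply/imset2P; exists 1 1; rewrite ?group1 ?mulg1 //.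
    apply/imsetP; exists (gval T); last by rewrite repr_group.
    by rewrite -[X in X \in _]rcoset1 mem_rc.
  rewrite big_ord_recr /=; have /= := IHn (fun i => f (widen_ord (leqnSn n) i)).
  case/(_ (fun i => Sf _))/mulsgP => t _ T0t /imsetP[A RA ->] ->.
  set g := f ord_max; have Sg : g \in S by apply: Sf.
  have Lg : g \in L by apply: mem_gen.
  have LAg : repr A * g \in L by rewrite groupM ?reprL.
  pose B := T :* (repr A * g); have RB : B \in R by apply: mem_rc.
  apply/imset2P; exists (t * (repr A * g * (repr B)^-1)) (repr B).
  - apply: groupM T0t _; apply/mem_gen/setIP; split.
      by apply/imsetP; exists ((A, g), B); rewrite // !inE RA Sg RB.
    by rewrite -mem_rcoset rcoset_sym mem_repr_rcoset.
  - exact: imset_f.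
  - by rewrite -!mulgA mulVg mulg1.
apply: leq_trans (subset_leq_card sLT0) _; rewrite /schur_bound.
have sub : T0 * [set repr A | A in R] \subset
    [set u.1 * u.2 | u in setX T0 [set repr A | A in R]].
  apply/subsetP=> _ /mulsgP[x y T0x Ry ->]; apply/imsetP.
  by exists (x, y); rewrite // inE T0x Ry.
rewrite (leq_trans (subset_leq_card sub)) // (leq_trans (leq_imset_card _ _)) //.
by rewrite cardsX leq_mul // (leq_trans (leq_imset_card _ _)).
Qed.

End Counting.

(** * Groups with few commutators, and criteria for cyclicity *)

Definition der1_bound c e := (schur_bound (2 ^ (c * c)) * e ^ c)%N.

Section BoundedDerived.
Variable gT : finGroupType.
Implicit Types (G H K A B : {group gT}) (x y z : gT) (p : nat).

Lemma commg_setJ G x y : x \in commg_set G G -> y \in G -> x ^ y \in commg_set G G.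
Proof.
case/imset2P=> a b Ga Gb -> Gy; rewrite conjRg.
by apply/imset2P; exists (a ^ y) (b ^ y); rewrite ?groupJ.
Qed.

(** The commutators generate G', so the action of G' on them by conjugation has kernel Z(G'). This
    bounds |G' : Z(G')|, and Schur's theorem bounds G''. The abelian group G'/G'' is generated by at
    most c elements of exponent e. *)
Lemma card_der1_few_commutators G c e :
  0 < e -> #|commg_set G G| <= c -> {in commg_set G G, forall x, x ^+ e = 1} ->
  #|G^`(1)| <= der1_bound c e.
Proof.
set X := commg_set G G => e_gt0 leXc Xe; pose D := G^`(1)%G.
have sDG : D \subset G := der_sub 1 G.
have leDZ : #|D : 'Z(D)| <= 2 ^ (c * c).
  (* The graph of conjugation by y, a subset of the square of X; hence the bound 2 ^ (c * c). *)
  pose phi y := [set (x, x ^ y) | x in X].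
  apply: (@leq_trans #|powerset (setX X X)|); last first.
    by rewrite card_powerset cardsX leq_pexp2l // leq_mul.
  apply: (index_leq_rep (phi := phi)); first exact: center_sub.
    move=> y Dy; rewrite inE; apply/subsetP=> _ /imsetP[x Xx ->].
    by rewrite inE Xx commg_setJ // (subsetP sDG).
  move=> y z Dy Dz eq_yz; apply/centerP; rewrite groupM ?groupV //; split=> // x Dx.
  have cX : X \subset 'C[y * z^-1].
    apply/subsetP=> u Xu; rewrite cent1C; apply/cent1P/commute_sym/commgP/conjg_fixP.
    have : (u, u ^ y) \in phi z by rewrite -eq_yz; apply: imset_f.
    by case/imsetP=> _ _ [<- uy]; rewrite conjgM uy conjgK.
  have : x \in 'C[y * z^-1] by apply: subsetP Dx; rewrite gen_subG.
  by rewrite cent1C => /cent1P.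
have leD2 := card_der1_schur leDZ.
rewrite -[#|_|]/#|D| -(Lagrange (der_sub 1 D)) leq_mul //.
rewrite -card_quotient ?der_norm //.
have nX : X \subset 'N(D^`(1)).
  by apply: subset_trans (der_norm 1 D); apply: subset_gen.
have defQ : D / D^`(1) = <<X / D^`(1)>> by rewrite quotient_gen.
have le_XQ : #|X / D^`(1)| <= c.
  by apply: leq_trans leXc; rewrite quotientE morphimEsub // leq_imset_card.
rewrite defQ; apply: leq_trans (card_gen_abelian _ _ e_gt0) _; last first.
- by rewrite leq_pexp2l.
- by move=> _ /morphimP[x Nx Xx ->]; rewrite -morphX // Xe // morph1.
- by rewrite -defQ sub_der1_abelian.
Qed.

Lemma expg_gen_abelian (S : {set gT}) n H :
  abelian <<S>> -> {in S, forall x, x ^+ n \in H} ->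
  {in <<S>>, forall x, x ^+ n \in H}.
Proof.
move=> abS SH _ /gen_prodgP[k [f Sf ->]].
elim: k f Sf => [|k IHk] f Sf; first by rewrite big_ord0 expg1n group1.
rewrite big_ord_recr /= expgMn; last first.
  by apply: (centsP abS); rewrite ?group_prod ?mem_gen // => i _; rewrite mem_gen.
by apply: groupM; [apply: (IHk (fun i => f (widen_ord _ i))) | apply: SH].
Qed.

Lemma constt_gen_abelian (S : {set gT}) p H :
  abelian <<S>> -> {in S, forall x, x.`_p \in H} ->
  {in <<S>>, forall x, x.`_p \in H}.
Proof.
move=> abS SH _ /gen_prodgP[k [f Sf ->]].
elim: k f Sf => [|k IHk] f Sf; first by rewrite big_ord0 constt1 group1.
rewrite big_ord_recr /= consttM; last first.
  by apply: (centsP abS); rewrite ?group_prod ?mem_gen // => i _; rewrite mem_gen.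
by apply: groupM; [apply: (IHk (fun i => f (widen_ord _ i))) | apply: SH].
Qed.

(** It suffices that the Sylow subgroups are cyclic. By nestedness, a p-part of largest order among
    the generators has all other p-parts as powers, so the Sylow p-subgroup lies in the cyclic group
    that it generates. *)
Lemma cyclic_gen_nested (S : {set gT}) :
  abelian <<S>> ->
  (forall p, prime p -> {in S &, forall x y, nested x.`_p y.`_p}) ->
  cyclic <<S>>.
Proof.
move=> abS Snest; apply: nil_Zgroup_cyclic; last exact: abelian_nil.
apply/forall_inP=> P /SylowP[p p_pr sylP].
have [s0 Ss0|S0] := pickP [in S]; last first.
  apply: cyclicS (cyclic1 _); apply: subset_trans (pHall_sub sylP) _.
  by rewrite gen_subG; apply/subsetP=> x; rewrite [x \in S]S0.
have [s Ss maxs] := @arg_maxnP gT s0 [in S] (fun s => #[s.`_p]) Ss0.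
suff : P \subset <[s.`_p]> by move/cyclicS; apply; apply: cycle_cyclic.
apply/subsetP=> x Px; rewrite -[x](@constt_p_elt _ p); last first.
  exact: mem_p_elt (pHall_pgroup sylP) Px.
apply: (constt_gen_abelian (H := <[s.`_p]>%G) abS) => [y Sy|]; last first.
  exact: subsetP (pHall_sub sylP) x Px.
by apply: nested_maxP; [apply: Snest | apply: maxs].
Qed.

Lemma cyclic_gen_pairwise (S : {set gT}) :
  abelian <<S>> ->
  {in S &, forall x y, exists2 z, x \in <[z]> & y \in <[z]>} -> cyclic <<S>>.
Proof.
move=> abS Spair; apply: cyclic_gen_nested => // p _ x y Sx Sy.
have [z xz yz] := Spair x y Sx Sy.
apply: (@nested_cycle _ p z); rewrite ?p_elt_constt //.
  by apply: subsetP (cycle_constt p x); rewrite cycle_subG.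
by apply: subsetP (cycle_constt p y); rewrite cycle_subG.
Qed.
End BoundedDerived.

(** * Covers in quotients, and cosets consisting of commutators *)

Lemma comm_cover_quotient m (gT : finGroupType) (c : 'I_m -> gT)
    (G N : {group gT}) :
  G \subset 'N(N) -> comm_cover G c -> comm_cover (G / N) (fun i => coset N (c i)).
Proof.
move=> nNG [Gc cov]; split=> [i|_ _ /morphimP[x Nx Gx ->] /morphimP[y Ny Gy ->]].
  by rewrite mem_quotient.
have [i xyi] := cov x y Gx Gy; exists i; rewrite -morphR //.
have Ni := subsetP nNG _ (Gc i).
by rewrite -quotient_cycle // mem_quotient.
Qed.

(** When a and b range over an abelian normal subgroup, the factor after [g^-1, h^-1] is a
    homomorphism in the pair (a, b); the commutators on the left thus form a coset of its image. *)
Lemma commg_translate (gT : groupType) (g h a b : gT) : commute a b ->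
  [~ a * g^-1, b * h^-1] =
    [~ g^-1, h^-1] * ([~ a, h]^-1 * [~ b, g]) ^ (h * g)^-1.
Proof.
move=> cab; have cab' : a * b^-1 = b^-1 * a by apply: commuteV.
rewrite !commgEl !conjgE !invMg !invgK !mulgA !(mulgK, mulgKV).
by rewrite -!mulgA; do 3 congr (_ * _); rewrite !mulgA cab'.
Qed.

Section Slices.
Variables (m : nat) (gT : finGroupType) (G : {group gT}) (c : 'I_m -> gT).
Hypothesis cov : comm_cover G c.
Local Notation nu := (m`!).

(* If A is an abelian normal subgroup then the commutators [ag, bh] with
   a, b in A form a coset of a conjugate of [A, h^-1][A, g^-1]. *)
Lemma action_pair (A : {group gT}) g h :
    A <| G -> abelian A -> g \in G -> h \in G ->
  exists z, {in A, forall a, [~ a, g] ^+ nu \in <[z]> /\ [~ a, h] ^+ nu \in <[z]>}.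
Proof.
move=> /andP[sAG nAG] abA Gg Gh.
have nA x a : x \in G -> a \in A -> a ^ x \in A.
  by move=> Gx Aa; rewrite memJ_norm // (subsetP nAG).
have cA : {in A &, forall a b, a * b = b * a} by move=> a b Aa Ab; apply: (centsP abA).
have AR x a : x \in G -> a \in A -> [~ a, x] \in A.
  by move=> Gx Aa; rewrite commgEl groupM ?groupV ?nA.
have RM x : x \in G -> {in A &, {morph commg^~ x : a b / a * b}}.
  by move=> Gx a b Aa Ab; rewrite commMgJ [_ ^ b]conjgE (cA [~ a, x]) ?mulKg ?AR.
pose phi (u : gT * gT) := ([~ u.1, h]^-1 * [~ u.2, g]) ^ (h * g)^-1.
have phiM : {in setX A A &, {morph phi : u v / u * v}}.
  move=> [a b] [a' b'] /setXP[/= Aa Ab] /setXP[/= Aa' Ab'].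
  rewrite /phi /= !RM // -conjMg invMg; congr (_ ^ _).
  have [Au Au' Av] : [/\ [~ a, h] \in A, [~ a', h] \in A & [~ b, g] \in A].
    by split; apply: AR.
  move: [~ a, h] [~ a', h] [~ b, g] [~ b', g] Au Au' Av => u u' v v' Au Au' Av.
  rewrite (cA u'^-1) ?groupV // -!mulgA; congr (_ * _).
  by rewrite !mulgA; congr (_ * _); apply: cA; rewrite ?groupV.
pose f := Morphism phiM; pose B := (f @* setX A A)%G.
have sBA : B \subset A.
  apply/subsetP=> _ /morphimP[[a b] _ /setXP[/= Aa Ab] ->] /=.
  apply: nA; first by rewrite groupV groupM.
  by apply: groupM; rewrite ?groupV; apply: AR.
have covB b : b \in B -> exists i, [~ g^-1, h^-1] * b \in <[c i]>.
  case/morphimP=> -[a b'] _ /setXP[/= Aa Ab] ->.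
  have [] := cov.2 (a * g^-1) (b' * h^-1).
  - by rewrite groupM ?groupV // (subsetP sAG).
  - by rewrite groupM ?groupV // (subsetP sAG).
  by move=> i; rewrite commg_translate => [Ci|]; [exists i | apply: cA].
have [i [_ Bi]] := cover_exp (abelianS sBA abA) covB.
(* Conjugating the generator undoes the conjugation in [phi]; the pairs (1, a) and (a, 1) then give
   the two memberships. *)
exists (c i ^ (h * g)) => a Aa.
have key u : u \in setX A A -> (phi u ^ (h * g)) ^+ nu \in <[c i ^ (h * g)]>.
  move=> Au; rewrite -conjXg cycleJ memJ_conjg; apply: Bi.
  by apply: (mem_morphim f).
split.
  have := key (1, a); rewrite !inE /phi /= conjgKV comm1g invg1 mul1g.
  by rewrite group1 Aa; apply.
have := key (a, 1); rewrite !inE /phi /= conjgKV comm1g mulg1 expgVn groupV.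
by rewrite group1 Aa; apply.
Qed.

(** By [action_pair] the nu-th powers of all [b, h] with b in A lie pairwise in common cyclic
    groups, so they generate a cyclic group. It is normalised by G, whose action on it is abelian,
    so G' centralises it. *)
Lemma center_action (A : {group gT}) a g :
    A <| G -> abelian A -> a \in A -> g \in G ->
  G^`(1) \subset 'C[[~ a, g] ^+ nu].
Proof.
move=> nsAG abA Aa Gg; have /andP[sAG nAG] := nsAG.
pose S := [set [~ u.1, u.2] ^+ nu | u in setX A G].
have SP b h : b \in A -> h \in G -> [~ b, h] ^+ nu \in S.
  by move=> Ab Gh; apply/imsetP; exists (b, h); rewrite // inE Ab Gh.
have sSA : S \subset A.
  apply/subsetP=> _ /imsetP[[b h] /setXP[/= Ab Gh] ->].
  by rewrite groupX // commgEl groupM ?groupV // memJ_norm // (subsetP nAG).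
have abS : abelian <<S>> by apply: abelianS abA; rewrite gen_subG.
have /cyclicP[w defW] : cyclic <<S>>.
  apply: cyclic_gen_pairwise => // x y.
  case/imsetP=> -[b h] /setXP[/= Ab Gh] -> /imsetP[[b' h'] /setXP[/= Ab' Gh'] ->].
  have [z zP] := action_pair nsAG abA Gh Gh'.
  by exists z; [case: (zP b Ab) | case: (zP b' Ab')].
have nWG : G \subset 'N(<[w]>).
  rewrite -defW; apply/subsetP=> x Gx; rewrite inE -genJ genS //.
  apply/subsetP=> _ /imsetP[_ /imsetP[[b h] /setXP[/= Ab Gh] ->] ->].
  rewrite conjXg conjRg; apply: SP; last by rewrite groupJ.
  by rewrite memJ_norm // (subsetP nAG).
have cW : G^`(1) \subset 'C[w].
  rewrite gen_subG; apply/subsetP=> _ /imset2P[x y Gx Gy ->].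
  by apply: norm_cycle_commC; apply: subsetP nWG _ _.
have /cycleP[k ->] : [~ a, g] ^+ nu \in <[w]> by rewrite -defW mem_gen // SP.
apply: subset_trans cW _; apply/subsetP=> x; rewrite cent1C => /cent1P cx.
by rewrite cent1C; apply/cent1P/commute_sym/commuteX/commute_sym.
Qed.
End Slices.

(* The shape of the hypotheses comes from x = [a, b], y = [c, d], u = [a, d] and
   v = [c, b], for which x v = [ac, b] and u y = [ac, d] in class two. *)
Lemma nested_cross (gT : finGroupType) (p : nat) (x y u v : gT) :
    prime p -> p.-elt x -> p.-elt y -> p.-elt u -> p.-elt v ->
    nested x u -> nested y u -> nested x v -> nested y v ->
    nested (x * v) (u * y) -> commute u y -> nested x y.
Proof.
move=> p_pr px py pu pv xu yu xv yv xv_uy cuy.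
(* Take a = x and w = v. If x lies in [<[v]>], then x and y are nested through v. Otherwise v lies
   in [<[x ^+ p]>], so that x v and x generate the same group. The same applies to y and u, and the
   nesting of x v with u y becomes that of x with y. *)
have shrink a w : p.-elt a -> p.-elt w -> nested a w -> nested x w -> nested y w ->
    (a = x \/ a = y) -> nested x y \/ w \in <[a ^+ p]>.
  move=> pa pw naw nxw nyw axy.
  have [aw|waP] := boolP (a \in <[w]>); last first.
    by right; move: naw; rewrite /nested (negbTE waP) /= => /(cycle_sub_or_gen p_pr pa);
       rewrite (negbTE waP).
  left.
  case: axy aw => -> aw.
    case/orP: nyw => [yw|wy]; last first.
      by rewrite /nested; apply/orP; left; apply: subsetP aw; rewrite cycle_subG.
    exact: (@nested_cycle _ p w).
  case/orP: nxw => [xw|wx]; last first.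
    by rewrite /nested; apply/orP; right; apply: subsetP aw; rewrite cycle_subG.
  exact: (@nested_cycle _ p w).
have [//|vx] := shrink x v px pv xv xv yv (or_introl erefl).
have [//|uy] := shrink y u py pu yu xu yu (or_intror erefl).
have xxv := gen_mul_Xp p_pr px vx.
have yuy : y \in <[u * y]> by rewrite cuy; apply: gen_mul_Xp p_pr py uy.
have xvx : x * v \in <[x]>.
  rewrite groupM ?cycle_id //; apply: subsetP vx.
  by rewrite cycle_subG mem_cycle.
have uyy : u * y \in <[y]>.
  rewrite groupM ?cycle_id //; apply: subsetP uy.
  by rewrite cycle_subG mem_cycle.
rewrite /nested; apply/orP; case/orP: xv_uy => [h|h]; [left|right].
  have : <[u * y]> \subset <[y]> by rewrite cycle_subG.
  by move/subsetP; apply; apply: subsetP xxv; rewrite cycle_subG.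
have : <[x * v]> \subset <[x]> by rewrite cycle_subG.
by move/subsetP; apply; apply: subsetP yuy; rewrite cycle_subG.
Qed.

(** * Groups of class two *)

Section ClassTwo.
Variables (m p : nat) (gT : finGroupType) (G : {group gT}) (c : 'I_m -> gT).
Hypotheses (cov : comm_cover G c) (p_pr : prime p).
Hypotheses (pG' : p.-group G^`(1)) (cG' : G^`(1) \subset 'C(G)).
Local Notation nu := (m`!).

Let comm_in : {in G &, forall x y, [~ x, y] \in G^`(1)}.
Proof. by move=> x y Gx Gy; rewrite mem_commg. Qed.

Let comm_fix : {in G & &, forall x y z, [~ x, y] ^ z = [~ x, y]}.
Proof.
move=> x y z Gx Gy Gz; apply/conjg_fixP/commgP.
by apply: (centsP cG') => //; apply: comm_in.
Qed.

Let p_comm : {in G &, forall x y, p.-elt ([~ x, y] ^+ nu)}.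
Proof. by move=> x y Gx Gy; rewrite p_eltX // (mem_p_elt pG') ?comm_in. Qed.

(** Commutators being central, y |-> [a, y] is a homomorphism on G. Its image is a subgroup
    consisting of commutators, and [cover_exp] applies with z = 1. *)
Lemma class2_slice a b b' : a \in G -> b \in G -> b' \in G ->
  nested ([~ a, b] ^+ nu) ([~ a, b'] ^+ nu).
Proof.
move=> Ga Gb Gb'.
have fM : {in G &, {morph commg a : x y / x * y}}.
  move=> x y Gx Gy; rewrite /= commgMJ comm_fix //.
  by apply: (centsP cG'); rewrite ?comm_in // (subsetP (der_sub 1 G)) ?comm_in.
have sfG : Morphism fM @* G \subset 'C(G).
  apply/subsetP=> _ /morphimP[x _ Gx ->]; apply: subsetP cG' _ _.
  exact: comm_in.
have abB : abelian (Morphism fM @* G).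
  apply: subset_trans sfG _; apply: centS; apply/subsetP=> _ /morphimP[x _ Gx ->].
  by rewrite /= groupR.
have [x|i [_ Ci]] := cover_exp (c := c) (z := 1) abB.
  by case/morphimP=> y _ Gy -> /=; rewrite mul1g; apply: cov.2.
have {}Ci x : x \in G -> [~ a, x] ^+ nu \in <[c i]>.
  by move=> Gx; apply: Ci; apply: (mem_morphim (Morphism fM)).
by apply: (@nested_cycle _ p (c i)); rewrite ?p_comm ?Ci.
Qed.

Lemma class2_slicel a b b' : a \in G -> b \in G -> b' \in G ->
  nested ([~ b, a] ^+ nu) ([~ b', a] ^+ nu).
Proof.
move=> Ga Gb Gb'; rewrite -[[~ b, a]]invgR -[[~ b', a]]invgR !expgVn.
by rewrite nestedVl nested_sym nestedVl nested_sym class2_slice.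
Qed.

Lemma class2_nested a b x y : a \in G -> b \in G -> x \in G -> y \in G ->
  nested ([~ a, b] ^+ nu) ([~ x, y] ^+ nu).
Proof.
move=> Ga Gb Gx Gy.
have cc u v z t : u \in G -> v \in G -> z \in G -> t \in G ->
    commute [~ u, v] [~ z, t].
  by move=> Gu Gv Gz Gt; apply: (centsP cG'); rewrite ?comm_in ?groupR.
apply: (@nested_cross _ p _ _ ([~ a, y] ^+ nu) ([~ x, b] ^+ nu)); rewrite ?p_comm //.
- exact: class2_slice.
- exact: class2_slicel.
- exact: class2_slicel.
- exact: class2_slice.
- rewrite -!expgMn; try exact: cc.
  rewrite -{1}(comm_fix Ga Gb Gx) -(comm_fix Ga Gy Gx) -!commMgJ.
  by apply: class2_slice; rewrite ?groupM.
- by apply: commuteX; apply: commute_sym; apply: commuteX; apply: cc.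
Qed.
End ClassTwo.

(** * Metabelian groups whose derived subgroup is a p-group *)

Section MetabelianPgroup.
Variables (m p : nat) (gT : finGroupType) (G : {group gT}) (c : 'I_m -> gT).
Hypotheses (cov : comm_cover G c) (p_pr : prime p).
Hypotheses (pV : p.-group G^`(1)) (abV : abelian G^`(1)).
Local Notation nu := (m`!).
Local Notation V := (G^`(1)%G).

Let nVG : G \subset 'N(V). Proof. exact: der_norm. Qed.
Let sVG : V \subset G. Proof. exact: der_sub. Qed.
Let VJ v g : v \in V -> g \in G -> v ^ g \in V.
Proof. by move=> Vv Gg; rewrite memJ_norm // (subsetP nVG). Qed.
Let comm_in : {in G &, forall x y, [~ x, y] \in V}.
Proof. by move=> x y Gx Gy; rewrite mem_commg. Qed.
Let cV : {in V &, forall x y, commute x y}.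
Proof. by move=> x y Vx Vy; apply: (centsP abV). Qed.
Let VG v : v \in V -> v \in G. Proof. exact: (subsetP sVG). Qed.
Let fixV : {in V &, forall x y, x ^ y = x}.
Proof. by move=> x y Vx Vy; apply/conjg_fixP/commgP/cV. Qed.
Let pel n v : v \in V -> p.-elt (v ^+ n).
Proof. by move=> Vv; rewrite p_eltX // (mem_p_elt pV). Qed.

(* The coset [a, b][V, b] = {[av, b]} consists of commutators. *)
Lemma translate_slice a b : a \in G -> b \in G ->
  exists i, [~ a, b] ^+ nu \in <[c i]> /\
            {in V, forall v, [~ v, b] ^+ nu \in <[c i]>}.
Proof.
move=> Ga Gb.
have fM : {in V &, {morph commg^~ b : x y / x * y}}.
  by move=> x y Vx Vy; rewrite /= commMgJ fixV // comm_in // VG.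
have sB : Morphism fM @* V \subset V.
  by apply/subsetP=> _ /morphimP[x _ Vx ->]; exact: comm_in (VG Vx) Gb.
have [x|i [[v0 Bv0 Cv0] Ci]] :=
    cover_exp (c := c) (z := [~ a, b]) (abelianS sB abV).
  case/morphimP=> v _ Vv ->.
  have [] := cov.2 (a * v) b; rewrite ?groupM ?(VG Vv) // => i.
  by rewrite commMgJ fixV ?comm_in //; exists i.
exists i; split=> [|v Vv]; last by apply: Ci; apply: (mem_morphim (Morphism fM)).
have Vv0 := subsetP sB _ Bv0.
rewrite -[_ ^+ nu](mulgK (v0 ^+ nu)) -expgMn; last by apply: cV; rewrite ?comm_in.
by apply: groupM; rewrite ?groupV; [apply: groupX | apply: Ci].
Qed.

Lemma translate_nested a b w : a \in G -> b \in G ->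
    (exists2 v, v \in V & w \in <[[~ v, b] ^+ nu]>) ->
  nested ([~ a, b] ^+ nu) w.
Proof.
move=> Ga Gb [v Vv wv]; have [i [Ci Vi]] := translate_slice Ga Gb.
apply: (@nested_cycle _ p (c i)) => //; first by rewrite pel ?comm_in.
  by case/cycleP: (wv) => k ->; rewrite p_eltX // pel // comm_in // VG.
by apply: subsetP wv; rewrite cycle_subG Vi.
Qed.

Lemma translate_nestedl a b w : a \in G -> b \in G ->
    (exists2 v, v \in V & w \in <[[~ v, a] ^+ nu]>) ->
  nested ([~ a, b] ^+ nu) w.
Proof.
move=> Ga Gb; rewrite -[[~ a, b]]invgR expgVn nestedVl.
exact: translate_nested.
Qed.

(** Any two of the elements [v, h]^nu are nested by [action_pair], so one of largest order generates
    all the others. *)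
Lemma max_action : exists alpha g, [/\ alpha \in V, g \in G &
  {in V & G, forall v h, [~ v, h] ^+ nu \in <[[~ alpha, g] ^+ nu]>}].
Proof.
pose D := setX V G; have D1 : (1, 1) \in D by rewrite inE /= !group1.
have [[al g] /setXP[/= Val Gg] maxw] :=
  @arg_maxnP _ (1, 1) [in D] (fun u : gT * gT => #[[~ u.1, u.2] ^+ nu]) D1.
exists al, g; split=> // v h Vv Gh; apply: nested_maxP; last first.
  by apply: (maxw (v, h)); rewrite inE /= Vv.
have [z zP] := action_pair cov (der_normal 1 G) abV Gg Gh.
have [[_ zh] [zg _]] := (zP v Vv, zP al Val).
by apply: (@nested_cycle _ p z); rewrite // pel // comm_in // VG.
Qed.

(* Modulo [V, G] the commutator map is bilinear. *)
Lemma der1_mod_action w :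
    w \in V ->
    {in V & G, forall v h, [~ v, h] ^+ nu \in <[w]>} ->
  exists a b, [/\ a \in G, b \in G & {in G &, forall x y, exists l : nat,
    exists2 u, u \in <[w]> &
      [~ x, y] ^+ (nu * nu) = [~ a, b] ^+ (nu * nu * l) * u}].
Proof.
move=> Vw maxw; pose K := [~: V, G]%G.
have nsKG : K <| G.
  by rewrite /normal commg_subr (subset_trans sVG (normG G)) commg_normr.
have sKV : K \subset V by rewrite commg_subl.
have pQ : p.-group (G / K)^`(1).
  by rewrite -quotient_der ?quotient_pgroup ?normal_norm.
have cQ : (G / K)^`(1) \subset 'C(G / K).
  rewrite -quotient_der ?normal_norm //; apply: quotient_cents2r.
  exact: subxx.
have covQ := comm_cover_quotient (normal_norm nsKG) cov.
pose D := setX G G; have D1 : (1, 1) \in D by rewrite inE /= !group1.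
(* Choose [a, b]^nu of largest order modulo K; by [class2_nested] it generates every other [x, y]^nu
   modulo K. *)
pose f (u : gT * gT) := coset K ([~ u.1, u.2] ^+ nu).
have [[a b] /setXP[/= Ga Gb] maxf] :=
  @arg_maxnP _ (1, 1) [in D] (fun u => #[f u]) D1.
have nK x : x \in G -> x \in 'N(K) by apply: subsetP (normal_norm nsKG) x.
have fE x y : x \in G -> y \in G -> f (x, y) = [~ coset K x, coset K y] ^+ nu.
  by move=> Gx Gy; rewrite /f morphX ?morphR /= ?nK ?groupR.
have abK : abelian K by apply: abelianS sKV abV.
have Kw : {in K, forall k, k ^+ nu \in <[w]>}.
  apply: expg_gen_abelian => // _ /imset2P[v h Vv Gh ->]; exact: maxw.
exists a, b; split=> // x y Gx Gy.
have /cycleP[l fl] : f (x, y) \in <[f (a, b)]>.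
  apply: nested_maxP; last by apply: (maxf (x, y)); rewrite inE /= Gx.
  by rewrite !fE // (class2_nested covQ p_pr pQ cQ) ?mem_quotient.
(* The second factor nu in the exponent carries the error term, an element of K, into [<[w]>]. *)
exists l, (((([~ a, b] ^+ nu) ^+ l)^-1 * [~ x, y] ^+ nu) ^+ nu); last first.
  have [Vx Va] := (comm_in Gx Gy, comm_in Ga Gb).
  rewrite [X in _ = _ * X]expgMn; last by apply: cV; rewrite ?groupV !groupX.
  by rewrite expgVn -!expgM (mulnC l) mulnA mulKVg.
apply: Kw; apply: coset_idr; first by rewrite nK ?groupM ?groupV ?groupX ?groupR.
have nR u v n : u \in G -> v \in G -> [~ u, v] ^+ n \in 'N(K).
  by move=> Gu Gv; rewrite nK // groupX ?groupR.
have nRl : ([~ a, b] ^+ nu) ^+ l \in 'N(K) by rewrite groupX ?nR.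
rewrite morphM ?groupV ?nR // morphV // morphX ?nR //=.
by rewrite -[coset K ([~ x, y] ^+ nu)]/(f (x, y)) fl mulVg.
Qed.

(** Every [x, y]^n is a power of x0^n times an element of [<[w]>], where w generates all [v, h]^nu
    with v in V; so it suffices that x0^n and w are nested. This is [translate_nested] if a or b is
    [full]. Otherwise the argument is applied to a g and g in place of a, and the two results are
    divided. *)
Lemma metabelian_pgroup :
  exists t, {in V, forall v, v ^+ (nu * nu) \in <[t]>}.
Proof.
have [al [g [Val Gg maxw]]] := max_action.
have [w defw] : exists w, w = [~ al, g] ^+ nu by exists ([~ al, g] ^+ nu).
rewrite -defw in maxw.
have Vw : w \in V by rewrite defw groupX // comm_in // VG.
have [a [b [Ga Gb xP]]] := der1_mod_action Vw maxw.
set n := (nu * nu)%N in xP *; pose x0 := [~ a, b].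
have Vx0 : x0 \in V by apply: comm_in.
have pw : p.-elt w by rewrite defw pel // comm_in // VG.
have wJ h : h \in G -> w ^ h \in <[w]>.
  move=> Gh; rewrite {1}defw conjXg conjRg.
  by apply: maxw; [apply: VJ | apply: groupJ].
suff x0w : nested (x0 ^+ n) w.
  have [t tx tw] : exists2 t, x0 ^+ n \in <[t]> & w \in <[t]>.
    by case/orP: x0w => h; [exists w | exists (x0 ^+ n)]; rewrite ?cycle_id.
  exists t; apply: expg_gen_abelian => // _ /imset2P[x y Gx Gy ->].
  have [l [u wu ->]] := xP x y Gx Gy.
  rewrite expgM; apply: groupM; first exact: groupX.
  by apply: subsetP wu; rewrite cycle_subG.
pose full h := [exists v in V, w \in <[[~ v, h] ^+ nu]>].
have fullP h : reflect (exists2 v, v \in V & w \in <[[~ v, h] ^+ nu]>) (full h).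
  exact: exists_inP.
have nestX x y : x \in G -> y \in G -> nested ([~ x, y] ^+ nu) w ->
    nested ([~ x, y] ^+ n) w.
  move=> Gx Gy; rewrite expgM; apply: (@p_eltX_nested _ p) => //.
  by apply: pel; apply: comm_in.
have [/fullP fb|nfb] := boolP (full b).
  by apply: nestX => //; apply: translate_nested.
have [/fullP fa|nfa] := boolP (full a).
  by apply: nestX => //; apply: translate_nestedl.
have fg : exists2 v, v \in V & w \in <[[~ v, g] ^+ nu]>.
  by exists al; rewrite // defw cycle_id.
(* Since a is not full, [al, a]^nu lies in [<[w ^+ p]>]; multiplying w by a conjugate of it gives an
   element that still generates w. *)
have fag : exists2 v, v \in V & w \in <[[~ v, a * g] ^+ nu]>.
  exists al => //; rewrite commgMJ expgMn; last first.
    by apply: cV; rewrite ?VJ ?comm_in ?(VG Val).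
  rewrite -defw; apply: (gen_mul_Xp p_pr pw); rewrite -conjXg.
  have /(cycle_sub_or_gen p_pr pw) : [~ al, a] ^+ nu \in <[w]> by apply: maxw.
  have -> /= : (w \in <[[~ al, a] ^+ nu]>) = false.
    by apply: contraNF nfa => h; apply/fullP; exists al.
  case/cycleP=> k ->; have /cycleP[j wj] := wJ g Gg.
  rewrite 2!conjXg wj; have -> : w ^+ j ^+ p ^+ k = w ^+ p ^+ (j * k).
    by rewrite -!expgM mulnCA.
  exact: mem_cycle.
(* If w is a power of [x, y]^(n p), substitute the expression of [x, y]^n in terms of x0 and w. Then
   w times an element of [<[w ^+ p]>] is a power of x0^n, hence so is w. *)
have dich x y : x \in G -> y \in G -> nested ([~ x, y] ^+ nu) w ->
    nested (x0 ^+ n) w \/ [~ x, y] ^+ n \in <[w]>.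
  move=> Gx Gy /(nestX _ _ Gx Gy)/orP[|wx]; first by right.
  have px : p.-elt ([~ x, y] ^+ n) by rewrite pel ?comm_in.
  case/orP: (cycle_sub_or_gen p_pr px wx) => [|/cycleP[j wj]]; first by right.
  left; have [l [_ /cycleP[i ->] xE]] := xP x y Gx Gy.
  have Vxn : x0 ^+ n \in V by apply: groupX.
  have wE : w * w ^- (i * (p * j)) = x0 ^+ n ^+ (l * (p * j)).
    rewrite {1}wj -[_ ^+ p ^+ j]expgM xE expgMn; last by apply: cV; rewrite ?groupX.
    by rewrite -(expgM w) mulgK -!expgM -(mulnA n).
  have : w \in <[w * w ^- (i * (p * j))]>.
    apply: (gen_mul_Xp p_pr pw); rewrite groupV mulnCA expgM mem_cycle //.
  rewrite wE /nested => wx0; apply/orP; right; apply: subsetP wx0.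
  by rewrite cycle_subG mem_cycle.
have Gag := groupM Ga Gg.
have [//|k1] := dich (a * g) b Gag Gb (translate_nestedl Gag Gb fag).
have [//|k2] := dich g b Gg Gb (translate_nestedl Gg Gb fg).
rewrite /nested; apply/orP; left.
(* As [a g, b] = [a, b]^g [g, b], this conjugate is a quotient of two elements of [<[w]>], which g
   normalises. *)
have : (x0 ^+ n) ^ g \in <[w]>.
  rewrite conjXg -(mulgK ([~ g, b] ^+ n) (_ ^+ n)) -expgMn.
    by rewrite -commMgJ groupM ?groupV.
  by apply: cV; rewrite ?VJ ?comm_in.
move=> h; have nw : <[w]> :^ g = <[w]>.
  by apply/eqP; rewrite eqEcard -cycleJ cycle_subG wJ //= -!orderE orderJ.
by rewrite -nw memJ_conjg in h.
Qed.
End MetabelianPgroup.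

(** * Metabelian groups: powers and torsion of G' *)

Section Metabelian.
Variables (m : nat) (gT : finGroupType) (G : {group gT}) (c : 'I_m -> gT).
Hypotheses (cov : comm_cover G c) (abV : abelian G^`(1)).
Local Notation nu := (m`!).
Local Notation V := (G^`(1)%G).

Lemma expgM_abelian (n : nat) :
  {in V &, {morph (fun x : gT => x ^+ n) : x y / x * y}}.
Proof. by move=> x y Vx Vy; apply: expgMn; apply: (centsP abV). Qed.

(** One prime at a time: modulo the p'-part of V the derived subgroup is a p-group, and
    [metabelian_pgroup] applies. Membership lifts back to p-parts because the kernel is a
    p'-group. *)
Lemma metabelian_cyclic :
  exists2 d, d \in V & {in V, forall v, v ^+ (nu * nu) \in <[d ^+ (nu * nu)]>}.
Proof.
set n := (nu * nu)%N; pose f := Morphism (@expgM_abelian n).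
have abQ : abelian <<f @* V>> by rewrite genGid morphim_abelian.
have sVG : V \subset G := der_sub 1 G.
have cycQ : cyclic <<f @* V>>.
  apply: cyclic_gen_nested => // p p_pr a b /morphimP[x _ Vx ->].
  case/morphimP=> y _ Vy -> /=.
  pose K := 'O_p^'(V)%G.
  have nKG : G \subset 'N(K).
    by apply: char_norm_trans (pcore_char _ _) (der_norm _ _).
  have pQ : p.-group (G / K)^`(1).
    rewrite -quotient_der //= /pgroup card_quotient ?normal_norm ?pcore_normal //.
    have /and3P[_ _] := nilpotent_pcore_Hall p^' (abelian_nil abV).
    by rewrite pnatNK.
  have abQ' : abelian (G / K)^`(1) by rewrite -quotient_der // quotient_abelian.
  have [t tP] := metabelian_pgroup (comm_cover_quotient nKG cov) p_pr pQ abQ'.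
  have lift u : u \in V -> p.-elt (coset K (u ^+ n)) /\ coset K (u ^+ n) \in <[t]>.
    move=> Vu; have Nu : u \in 'N(K) by rewrite (subsetP nKG) ?(subsetP sVG).
    have Qu : coset K u \in (G / K)^`(1) by rewrite -quotient_der // mem_quotient.
    by rewrite morphX //= p_eltX ?(mem_p_elt pQ) ?tP.
  have key u v : u \in V -> v \in V -> coset K (u ^+ n) \in <[coset K (v ^+ n)]> ->
      (u ^+ n).`_p \in <[(v ^+ n).`_p]>.
    move=> Vu Vv /cycleP[j uj].
    have [Vun Vvn] : u ^+ n \in V /\ v ^+ n \in V by rewrite !groupX.
    have NV z : z \in V -> z \in 'N(K).
      by move=> Vz; rewrite (subsetP nKG) ?(subsetP sVG).
    have Kd : (v ^+ n ^+ j)^-1 * u ^+ n \in K.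
      apply: coset_idr; first by apply: NV; rewrite groupM ?groupV ?groupX.
      rewrite morphM ?groupV ?NV ?groupX // morphV ?NV ?groupX // morphX ?NV //=.
      by rewrite uj mulVg.
    rewrite -[u ^+ n](mulKVg (v ^+ n ^+ j)) consttM; last first.
      by apply: (centsP abV); rewrite ?groupM ?groupV ?groupX.
    have /constt1P-> : p^'.-elt ((v ^+ n ^+ j)^-1 * u ^+ n).
      exact: mem_p_elt (pcore_pgroup _ _) Kd.
    by rewrite mulg1 consttX mem_cycle.
  have [[px tx] [py ty]] := (lift x Vx, lift y Vy).
  by case/orP: (nested_cycle px py tx ty) => h; apply/orP; [left | right]; apply: key.
rewrite genGid in cycQ; have [q defQ] := cyclicP cycQ.
have : q \in f @* V by rewrite defQ cycle_id.
case/morphimP=> d _ Vd qE; exists d => // v Vv.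
by rewrite -[d ^+ n]/(f d) -qE -defQ; apply: (mem_morphim f).
Qed.

(** The n-th power map on V shows that the n-torsion has the order of V modulo its n-th powers. In
    that quotient V is generated by at most m * n commutators, all of exponent n. *)
Lemma metabelian_torsion n : 0 < n -> #|'Ldiv_n(V)| <= n ^ (m * n).
Proof.
move=> n_gt0; pose f := Morphism (@expgM_abelian n); pose Q := (f @* V)%G.
have sQV : Q \subset V.
  by apply/subsetP=> _ /morphimP[x _ Vx ->]; apply: groupX.
have sVG : V \subset G := der_sub 1 G.
have nQG : G \subset 'N(Q).
  apply/subsetP=> g Gg; rewrite inE.
  apply/subsetP=> _ /imsetP[_ /morphimP[x _ Vx ->] ->].
  rewrite /= conjXg; apply: (mem_morphim f); rewrite ?memJ_norm //;
    exact: (subsetP (der_norm 1 G)).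
have kerf : 'Ldiv_n(V) = 'ker f.
  by apply/setP=> x; rewrite !inE.
have -> : #|'Ldiv_n(V)| = #|V / Q|.
  rewrite card_quotient ?(subset_trans sVG nQG) //.
  have oQ : (#|'ker f| * #|Q|)%N = #|V|.
    by rewrite card_morphim setIid Lagrange // subsetIl.
  by apply/eqP; rewrite kerf -(eqn_pmul2l (cardG_gt0 Q)) Lagrange // mulnC oQ.
have Xn : {in commg_set (G / Q) (G / Q), forall x, x ^+ n = 1}.
  move=> _ /imset2P[_ _ /morphimP[x Nx Gx ->] /morphimP[y Ny Gy ->] ->].
  rewrite -morphR // -morphX ?groupR //; apply: coset_id.
  by apply: (mem_morphim f); apply: mem_commg.
have covQ := comm_cover_quotient nQG cov.
have leX := card_commg_set_cover n_gt0 covQ.2 Xn.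
have abQ : abelian <<commg_set (G / Q) (G / Q)>>.
  by rewrite -[<<_>>]/((G / Q)^`(1)) -quotient_der // quotient_abelian.
apply: leq_trans (leq_pexp2l n_gt0 leX).
by have := card_gen_abelian abQ Xn n_gt0; rewrite [V / Q]quotient_der.
Qed.
End Metabelian.

(** * Passage from G / G'' back to G *)

Section SecondDerived.
Variables (m : nat) (gT : finGroupType) (G : {group gT}) (c : 'I_m -> gT).
Hypothesis cov : comm_cover G c.
Local Notation nu := (m`!).
Local Notation D := (G^`(1)%G).
Local Notation D2 := (G^`(2)%G).

Lemma abelian_der_quotient : abelian (G / D2)^`(1).
Proof.
by rewrite -quotient_der ?der_norm //; apply: sub_der1_abelian (subxx _).
Qed.

(** Expressed by membership in G'', a form that can be carried along maps between finite
    quotients. *)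
Lemma der1_procyclic_mod : exists2 d, d \in D & {in D, forall x, exists j : nat,
  (d ^+ (nu * nu) ^+ j)^-1 * x ^+ (nu * nu) \in D2}.
Proof.
have nG := der_norm 2 G.
have [d0 Dd0 dP] :=
  metabelian_cyclic (comm_cover_quotient nG cov) abelian_der_quotient.
have /morphimP[d Nd Dd d0E] : d0 \in D / D2 by rewrite quotient_der.
rewrite {d0 Dd0}d0E in dP.
have DN x : x \in D -> x \in 'N(D2).
  by move=> Dx; rewrite (subsetP nG) // (subsetP (der_sub 1 G)).
exists d => // x Dx.
have /dP : coset D2 x \in (G / D2)^`(1)%G by rewrite /= -quotient_der // mem_quotient.
rewrite -!morphX ?DN // => /cycleP[j xj]; exists j.
apply: coset_idr; first by rewrite DN ?groupM ?groupV ?groupX.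
rewrite morphM ?morphV ?groupV ?DN ?groupX //= xj.
by rewrite [coset _ (_ ^+ j)]morphX ?mulVg ?DN ?groupX.
Qed.

(** A subgroup because G'/G'' is abelian; for n = (m!)^2 it is the subgroup M of the finite case. *)
Definition torsion_set n := [set x in G^`(1) | x ^+ n \in G^`(2)].

Lemma torsion_preim n : torsion_set n = coset D2 @*^-1 'Ldiv_n((G / D2)^`(1)).
Proof.
have nG := der_norm 2 G.
have DN x : x \in D -> x \in 'N(D2).
  by move=> Dx; rewrite (subsetP nG) // (subsetP (der_sub 1 G)).
apply/setP=> x; rewrite inE -quotient_der //; apply/andP/idP=> [[Dx xn]|].
  apply/morphpreP; split; first exact: DN.
  apply/LdivP; split; first exact: mem_quotient.
  by rewrite -morphX ?DN //; apply: coset_id.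
case/morphpreP=> Nx /LdivP[Dx xn].
have {}Dx : x \in G^`(1).
  have : x \in coset D2 @*^-1 (D / D2) by apply/morphpreP.
  by rewrite quotientGK // der_normalS.
by split=> //; apply: coset_idr; rewrite ?morphX ?groupX.
Qed.

Lemma torsion_group_set n : group_set (torsion_set n).
Proof.
rewrite torsion_preim.
exact: (groupP (coset D2 @*^-1 Group (group_Ldiv n abelian_der_quotient))).
Qed.

Lemma torsionJ n x g : x \in torsion_set n -> g \in G -> x ^ g \in torsion_set n.
Proof.
rewrite !inE => /andP[Dx xn] Gg; rewrite -conjXg.
by rewrite !memJ_norm ?Dx // (subsetP (der_norm _ G)).
Qed.

Lemma torsion_div n a y j : a \in D -> y \in D ->
  (a ^+ n ^+ j)^-1 * y ^+ n \in D2 -> (a ^+ j)^-1 * y \in torsion_set n.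
Proof.
move=> Da Dy; have nG := der_norm 2 G.
have DN x : x \in D -> x \in 'N(D2).
  by move=> Dx; rewrite (subsetP nG) // (subsetP (der_sub 1 G)).
have Dn x k : x \in D -> x ^+ k \in D by apply: groupX.
have [Daj Dan] : (a ^+ j)^-1 \in D /\ (a ^+ n ^+ j)^-1 \in D by rewrite !groupV !Dn.
move=> h; rewrite inE (groupM Daj Dy) /=.
apply: coset_idr; first by rewrite DN // Dn // groupM.
rewrite morphX ?DN ?groupM // morphM ?DN //= expgMn; last first.
  by apply: (centsP abelian_der_quotient); rewrite -quotient_der // mem_quotient.
rewrite -!morphX ?DN //= -morphM ?DN ?Dn //= expgVn -expgM mulnC expgM.
exact: coset_id.
Qed.

Lemma card_torsion n : 0 < n -> #|torsion_set n| <= #|G^`(2)| * n ^ (m * n).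
Proof.
move=> n_gt0; rewrite torsion_preim.
rewrite (card_cosetpre (Group (group_Ldiv n abelian_der_quotient))) leq_mul //.
apply: metabelian_torsion n_gt0; last exact: abelian_der_quotient.
exact: comm_cover_quotient (der_norm 2 G) cov.
Qed.
End SecondDerived.

(** * Bounding the second derived subgroup *)

Definition beta_bound m :=
  schur_bound (der1_bound (m * m`! ^ 3) (m`! ^ 3)).

(** With E = G' :&: N and K = [E, E], [beta_bound] bounds |G''/K|, and e bounds the exponent of K,
    an abelian group generated by at most m * e commutators. *)
Definition second_derived_bound m :=
  let e := ((m`! * m`!) ^ 2 * beta_bound m)%N in (e ^ (m * e) * beta_bound m)%N.

Section SecondDerivedBound.
Variables (m : nat) (gT : finGroupType) (G : {group gT}) (c : 'I_m -> gT).
Hypothesis cov : comm_cover G c.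
Local Notation nu := (m`!).
Local Notation D := (G^`(1)%G).
Local Notation X := (commg_set G G).

(** It contains all nu-th powers of elements of G, and the commutators of its elements centralise
    G'. *)
Definition comm_normalizer : {set gT} := G :&: \bigcap_(x in X) 'N(<[x]>).
Canonical comm_normalizer_group := [group of comm_normalizer].
Local Notation N := comm_normalizer.
Local Notation E := (G^`(1) :&: N)%G.

Lemma comm_normalizer_power y : y \in G -> y ^+ nu \in N.
Proof.
move=> Gy; rewrite inE groupX //; apply/bigcapP=> x Xx.
apply: (@normX_cycle _ m c G) => // h Gh.
by have /imset2P[a b Ga Gb ->] := commg_setJ Xx Gh; apply: cov.2.
Qed.

Lemma comm_normalizer_norm : G \subset 'N(N).
Proof.
apply/subsetP=> g Gg; rewrite inE.
apply/subsetP=> _ /imsetP[y /setIP[Gy /bigcapP Ny] ->].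
rewrite inE groupJ //; apply/bigcapP=> x Xx.
have Xxg : x ^ g^-1 \in X by apply: commg_setJ; rewrite ?groupV.
by rewrite -(conjgKV g x) cycleJ normJ memJ_conjg Ny.
Qed.

Lemma der1_normalizer_normal : E <| G.
Proof.
rewrite /normal subIset ?der_sub //= normsI ?der_norm //; exact: comm_normalizer_norm.
Qed.

Lemma der1_normalizer_central : E^`(1) \subset 'Z(D).
Proof.
rewrite gen_subG; apply/subsetP=> _ /imset2P[s t /setIP[Ds Ns] /setIP[Dt Nt] ->].
apply/setIP; split; first exact: groupR.
suff : [~ s, t] \in 'C(<<X>>) by [].
rewrite cent_gen; apply/centP=> x Xx.
have NP y : y \in N -> y \in 'N(<[x]>).
  by case/setIP=> _ /bigcapP Ny; apply: Ny.
exact/cent1P/(norm_cycle_commC (NP s Ns) (NP t Nt)).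
Qed.

Lemma der1_normalizer_power x : x \in D -> x ^+ nu \in E.
Proof.
by move=> Dx; rewrite inE groupX // comm_normalizer_power // (subsetP (der_sub 1 G)).
Qed.

Local Notation K := (E^`(1)%G).

Lemma der2_normalizer_norm : G \subset 'N(K).
Proof. exact: char_norm_trans (der_char _ _) (normal_norm der1_normalizer_normal). Qed.

(** In G / K the image of E is abelian and normal, so by [center_action] t = [a, z]^nu = [a^nu, z]
    commutes with z. Hence t^nu = [a^nu, z^nu], which is trivial because both entries lie in the
    abelian group E / K. *)
Lemma normalizer_power_central e y : e \in E -> y \in D ->
  [~ coset K (e ^+ (nu * nu)), coset K y] = 1.
Proof.
move=> Ee Dy; have sDG := subsetP (der_sub 1 G).
have NK x : x \in G -> x \in 'N(K) by apply: (subsetP der2_normalizer_norm).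
have Ge : e \in G by case/setIP: Ee => /sDG.
set a := coset K e; set z := coset K y.
have Aa : a \in E / K by rewrite mem_quotient.
have abA : abelian (E / K) by apply: sub_der1_abelian.
have nsA : E / K <| G / K by apply: quotient_normal der1_normalizer_normal.
have Gz : z \in G / K by rewrite mem_quotient ?sDG.
have := center_action (comm_cover_quotient der2_normalizer_norm cov) nsA abA Aa Gz.
rewrite -quotient_der ?der2_normalizer_norm // => /subsetP/(_ z (mem_quotient _ Dy)).
set t := [~ a, z] ^+ nu; rewrite cent1C => /cent1P ctz.
have nA u : u \in E / K -> [~ u, z] \in E / K.
  move=> Au; rewrite commgEl groupM ?groupV // memJ_norm //.
  exact: (subsetP (normal_norm nsA)).
have tE : t = [~ a ^+ nu, z].
  by rewrite commXg //; apply: (centsP abA); rewrite ?nA.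
rewrite morphX ?NK //= commXg; last by apply: (centsP abA); rewrite ?nA.
rewrite -/a -/z expgM -/t tE -commgX -?tE //; apply/eqP/commgP/(centsP abA).
  exact: groupX.
by rewrite /z -morphX ?NK ?sDG // mem_quotient ?der1_normalizer_power.
Qed.

(** A power nu brings commutators into E, and a further power nu^2 into the centre of D / K. So
    modulo this centre the commutators have exponent nu^3 and are few, which bounds the index of the
    centre; Schur's theorem concludes. *)
Lemma card_der2_mod_normalizer : #|(D / K)^`(1)| <= beta_bound m.
Proof.
have nKG := der2_normalizer_norm.
have NK x : x \in G -> x \in 'N(K) by apply: (subsetP nKG).
have defD : D / K = (G / K)^`(1) by rewrite quotient_der.
set Q := (D / K)%G; set Z := 'Z(Q)%G.
have nZG : G / K \subset 'N(Z).
  apply: char_norm_trans (center_char _) _; apply: quotient_norms.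
  exact: der_norm.
apply: card_der1_schur; rewrite -/Z.
have nu3 : 0 < m`! ^ 3 by rewrite expn_gt0 fact_gt0.
have sQG : Q \subset G / K by apply: quotientS (der_sub 1 G).
have -> : #|Q : 'Z(Q)| = #|((G / K) / Z)^`(1)|.
  by rewrite -quotient_der // -defD card_quotient // (subset_trans sQG nZG).
have cov2 := comm_cover_quotient nZG (comm_cover_quotient nKG cov).
have Xn : {in commg_set (G / K / Z) (G / K / Z), forall x, x ^+ (m`! ^ 3) = 1}.
  move=> _ /imset2P[_ _ /morphimP[x Nx Gx ->] /morphimP[y Ny Gy ->] ->].
  rewrite -morphR // -morphX ?groupR //; apply: coset_id.
  case/morphimP: Gx => x' Nx' Gx' ->; case/morphimP: Gy => y' Ny' Gy' ->.
  rewrite -morphR // -morphX ?groupR //.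
  have Ex : [~ x', y'] ^+ nu \in E by apply: der1_normalizer_power; apply: mem_commg.
  have Dx : [~ x', y'] \in D by apply: mem_commg.
  apply/centerP; split; first by rewrite mem_quotient ?groupX.
  move=> _ /morphimP[d Nd Dd ->]; apply/commgP/eqP.
  rewrite (expgM _ nu (nu ^ 2)) -mulnn.
  exact: normalizer_power_central.
apply: card_der1_few_commutators => //.
exact: card_commg_set_cover nu3 cov2.2 Xn.
Qed.

Lemma expg_der2_in_normalizer u : u \in G^`(2) -> u ^+ #|(D / K)^`(1)| \in K.
Proof.
move=> D2u; have nKG := der2_normalizer_norm.
have sDG : D \subset G := der_sub 1 G.
have NK x : x \in D -> x \in 'N(K) by move=> Dx; rewrite (subsetP nKG) ?(subsetP sDG).
have Du : u \in D by apply: subsetP (der_subS 1 G) u D2u.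
apply: coset_idr; first by rewrite NK ?groupX.
rewrite morphX ?NK //; apply: expg_cardG.
by rewrite /= -quotient_der ?(subset_trans sDG nKG) // mem_quotient.
Qed.

(** By [der1_procyclic_mod], e^n and f^n are powers of one d0 times elements u, v of G'' in E.
    Commutators on E are central in D, hence bilinear: powers of d0 commute, and the terms with u or
    v have trivial r-th power since u^r and v^r lie in the central subgroup K. *)
Lemma normalizer_comm_exponent e f : e \in E -> f \in E ->
  [~ e, f] ^+ ((nu * nu) ^ 2 * #|(D / K)^`(1)|) = 1.
Proof.
move=> Ee Ef; set n := (nu * nu)%N; set r := #|(D / K)^`(1)|.
have sED : E \subset D := subsetIl _ _.
have [De Df] := (subsetP sED _ Ee, subsetP sED _ Ef).
have KZ := der1_normalizer_central.
have comE a b : a \in E -> b \in E -> [~ a, b] \in 'Z(D).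
  by move=> Ea Eb; apply: (subsetP KZ); apply: mem_commg.
have cZ z x : z \in 'Z(D) -> x \in D -> commute z x.
  by case/centerP=> _ cz Dx; apply: cz.
have [d Dd dP] := der1_procyclic_mod cov.
pose d0 := d ^+ n; have Ed0 : d0 \in E.
  by rewrite /d0 /n expgM groupX // der1_normalizer_power.
have [[i ei] [j fj]] := (dP e De, dP f Df).
set u := _ * _ in ei; set v := _ * _ in fj.
have Eu : u \in E by apply: groupM; rewrite ?groupV; apply: groupX.
have Ev : v \in E by apply: groupM; rewrite ?groupV; apply: groupX.
have eE : e ^+ n = d0 ^+ i * u by rewrite mulKVg.
have fE : f ^+ n = d0 ^+ j * v by rewrite mulKVg.
clearbody u v d0.
have kill a b : a \in E -> b \in E -> a \in G^`(2) -> [~ a, b] ^+ r = 1.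
  move=> Ea Eb /expg_der2_in_normalizer Ka.
  rewrite -commXg; last by apply: commute_sym; apply: cZ; rewrite ?comE ?(subsetP sED).
  by apply/eqP/commgP/cZ; rewrite ?(subsetP KZ) ?(subsetP sED).
have -> : [~ e, f] ^+ (n ^ 2 * r) = [~ e ^+ n, f ^+ n] ^+ r.
  rewrite expgM -mulnn expgM commXg; last first.
    by apply: commute_sym; apply: cZ; rewrite ?comE ?groupX ?(subsetP sED).
  rewrite commgX //.
  by apply: commute_sym; apply: cZ; rewrite ?comE ?groupX ?(subsetP sED).
rewrite eE fE; have DE x : x \in E -> x \in D by apply: (subsetP sED).
have Jfix a b z : a \in E -> b \in E -> z \in E -> [~ a, b] ^ z = [~ a, b].
  by move=> Ea Eb Ez; apply/conjg_fixP/commgP/cZ; rewrite ?comE ?DE.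
rewrite commMgJ Jfix ?groupM ?groupX // commgMJ Jfix ?groupM ?groupX //.
have -> : [~ d0 ^+ i, d0 ^+ j] = 1 by apply/eqP/commgP/commuteX2.
rewrite mulg1 expgMn; last first.
  apply: cZ; first by rewrite comE ?groupX.
  by apply: (subsetP (center_sub D)); rewrite comE ?groupM ?groupX.
rewrite (kill u) ?groupM ?groupX // mulg1.
by rewrite -invgR expgVn kill ?invg1 ?groupX.
Qed.

Lemma card_der2 : #|G^`(2)| <= second_derived_bound m.
Proof.
set r := #|(D / K)^`(1)|; set e := ((nu * nu) ^ 2 * r)%N.
have ler : r <= beta_bound m := card_der2_mod_normalizer.
have e_gt0 : 0 < e by rewrite muln_gt0 expn_gt0 muln_gt0 fact_gt0 cardG_gt0.
have Xe : {in commg_set E E, forall x, x ^+ e = 1}.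
  by move=> _ /imset2P[a b Ea Eb ->]; apply: normalizer_comm_exponent.
have covE : {in E &, forall x y, exists i, [~ x, y] \in <[c i]>}.
  by move=> x y /setIP[Dx _] /setIP[Dy _]; apply: cov.2; apply: (subsetP (der_sub 1 G)).
have leX := card_commg_set_cover e_gt0 covE Xe.
have abK : abelian <<commg_set E E>>.
  exact: abelianS der1_normalizer_central (center_abelian D).
have leK : #|K| <= e ^ (m * e).
  apply: leq_trans (card_gen_abelian abK Xe e_gt0) _.
  exact: leq_pexp2l.
have sKD2 : K \subset G^`(2) by apply: dergS (subsetIl _ _).
have nK : G^`(2) \subset 'N(K) by apply: subset_trans (der_sub 2 G) der2_normalizer_norm.
rewrite -(Lagrange sKD2) -card_quotient // /second_derived_bound.
have -> : #|G^`(2) / K| = r.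
  by rewrite /r -quotient_der // (subset_trans (der_sub 1 G) der2_normalizer_norm).
rewrite leq_mul //; apply: leq_trans leK _.
have lee : e <= (nu * nu) ^ 2 * beta_bound m by rewrite leq_mul2l ler orbT.
apply: (@leq_trans (e ^ (m * ((nu * nu) ^ 2 * beta_bound m)))).
  by rewrite leq_pexp2l // leq_mul2l lee orbT.
move: lee; move: ((nu * nu) ^ 2 * _)%N => b lee.
by elim: (m * _)%N => // k IHk; rewrite !expnS leq_mul.
Qed.
End SecondDerivedBound.

Require Import Defs.
From mathcomp Require Import all_classical.
From mathcomp Require Import topology.

Local Open Scope classical_set_scope.
Local Open Scope group_scope.

(** * Finite quotients of profinite groups *)

Section Compactness.
Variable T : topologicalType.
Implicit Types (A B K : set T).

(** The sets [K]&[E i] generate a proper filter, and a cluster point of it in K lies in every closed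
    [E i]. *)
Lemma compact_directed (I : Type) (E : I -> set T) K :
    compact K -> (forall i, closed (E i)) -> (exists i : I, True) ->
    (forall i j, exists k, E k `<=` E i `&` E j) ->
    (forall i, K `&` E i !=set0) ->
  exists2 x, K x & forall i, E i x.
Proof.
move=> cK clE [i0 _] dirE KE; pose F := filter_from setT (fun i => K `&` E i).
have FF : Filter F.
  apply: filter_from_filter; first by exists i0.
  move=> i j _ _; have [k kij] := dirE i j; exists k => // x [Kx /kij[Ei Ej]].
  by split.
have PF : ProperFilter F by apply: filter_from_proper => i _; apply: KE.
have FK : F K by exists i0 => // x [].
have [x [Kx xF]] := cK F PF FK; exists x => // i.
apply: clE => B Bx; have [||y [[_ Ey] By]] := xF (K `&` E i) B => //.
  by exists i.
by exists y.
Qed.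

Lemma hausdorff_set_type A :
  (forall x y, A x -> A y -> x != y -> exists U, [/\ clopen U, U x & ~ U y]) ->
  hausdorff_space (set_type A).
Proof.
move=> sepA x y xy; apply/eqP; case: eqP => // /eqP neq_xy; exfalso.
have vxy : val x != val y by apply: contra neq_xy => /eqP/val_inj->.
have [U [[oU cU] Ux Uy]] := sepA _ _ (set_valP x) (set_valP y) vxy.
have nx : nbhs x (val @^-1` U).
  by apply: (@initial_continuous _ _ val); apply: open_nbhs_nbhs.
have ny : nbhs y (val @^-1` (~` U)).
  apply: (@initial_continuous _ _ val); apply: open_nbhs_nbhs.
  by split=> //; apply: closed_openC.
by have [z []] := xy _ _ nx ny.
Qed.

Lemma hausdorff_set_typeT : hausdorff_space (set_type [set: T]) -> hausdorff_space T.
Proof.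
move=> hT x y xy.
pose s (z : T) : set_type [set: T] := SigSub (mem_set (I : [set: T] z)).
suff /(congr1 val) : s x = s y by [].
apply: hT => U V.
rewrite nbhsE => -[_ [[U' oU' <-] Ux] sU]; rewrite nbhsE => -[_ [[V' oV' <-] Vy] sV].
have nU : nbhs x U' by apply: open_nbhs_nbhs.
have nV : nbhs y V' by apply: open_nbhs_nbhs.
have [z [U'z V'z]] := xy U' V' nU nV.
by exists (s z); split; [apply: sU | apply: sV].
Qed.

Lemma separated_totally_disconnected A :
  (forall x y, A x -> A y -> x != y -> exists U, [/\ clopen U, U x & ~ U y]) ->
  totally_disconnected A.
Proof.
move=> sepA x Ax; rewrite eqEsubset; split=> [z [R [Rx RA ctdR] Rz]|_ ->].
  apply: contrapT => /eqP znx; have [U [[oU cU] Uz Ux]] := sepA _ _ (RA _ Rz) Ax znx.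
  suff RU : R `&` U = R by move: Rx; rewrite -RU => -[].
  by apply: ctdR; [exists z|exists U|exists U].
exact: connected_component_refl.
Qed.

(** In a compact Hausdorff space the intersection Q of the clopen sets around x is connected. A
    relatively clopen part B of Q is separated from the rest by normality; a clopen D around x
    inside the two separating open sets is cut by them into clopen pieces, and Q lies in the piece
    containing x. *)
Lemma compact_zero_dimensional :
  hausdorff_space T -> compact [set: T] -> totally_disconnected [set: T] ->
  zero_dimensional T.
Proof.
move=> hT cT tdT x y neq_xy; apply: contrapT => nsep.
pose Q := \bigcap_(D in [set D | clopen D /\ D x]) D.
have Qx : Q x by move=> D [].
have Qy : Q y.
  by move=> D [cD Dx]; apply: contrapT => nDy; apply: nsep; exists D.
have clQ : closed Q by apply: closed_bigI => D [[]].
suff conQ : connected Q.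
  have : connected_component [set: T] x y by exists Q => //; split.
  by rewrite tdT // => /esym/eqP; rewrite (negbTE neq_xy).
move=> B [b Bb] [C1 oC1 BC1] [C2 cC2 BC2].
have clB : closed B by rewrite BC2; apply: closedI.
have clQB : closed (Q `\` B).
  have -> : Q `\` B = Q `&` ~` C1.
    by rewrite BC1 setDE setCI setIUr setICr set0U.
  by apply: closedI => //; apply: open_closedC.
have nB : set_nbhs B (~` (Q `\` B)).
  apply/set_nbhsP; exists (~` (Q `\` B)); split=> //; first exact: closed_openC.
  by move=> z Bz [].
have [V /set_nbhsP[O [oO BO OV]] VQB] := compact_normal hT cT clB nB.
pose I := {D : set T | clopen D /\ D x}.
have [K1|] := pselect (exists D : I, sval D `<=` O `|` ~` closure V).
  have [[D [cD Dx]] /= sD] := K1.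
  have cDO : clopen (D `&` O).
    have [oD clD] := cD; split; first exact: openI.
    suff -> : D `&` O = D `&` closure V by apply: closedI => //; apply: closed_closure.
    apply/seteqP; split=> z [Dz]; first by move/OV/subset_closure.
    by move=> Vz; split=> //; case: (sD z Dz).
  have [DOx|nDOx] := pselect ((D `&` O) x).
    apply/seteqP; split=> z; first by rewrite BC1 => -[].
    move=> Qz; apply: contrapT => nBz.
    have [_ Oz] := Qz (D `&` O) (conj cDO DOx).
    by apply: (VQB z); [apply/subset_closure/OV | split].
  have cDO' : clopen (D `\` (D `&` O)).
    case: cD cDO => ? ? [? ?]; rewrite setDE; split.
      by apply: openI => //; apply: closed_openC.
    by apply: closedI => //; apply: open_closedC.
  have Qb : Q b by move: Bb; rewrite BC1 => -[].
  have [Db []] : (D `\` (D `&` O)) b by apply: Qb; split=> // -[].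
  by split=> //; apply: BO.
(* If no such D existed, the complement of the two open sets would meet every clopen D around x. By
   compactness it would then contain a point of Q. *)
move=> nK; pose E (D : I) := sval D `&` ~` (O `|` ~` closure V).
have cO : closed (~` (O `|` ~` closure V)).
  by apply: open_closedC; apply: openU => //; apply/closed_openC/closed_closure.
have [|||D|q _ Eq] := @compact_directed I E [set: T] cT.
- by move=> [D [[oD cD] Dx]]; apply: closedI.
- by exists (exist _ [set: T] (conj clopenT Logic.I)).
- move=> [D [cD Dx]] [D' [cD' Dx']].
  have DD : clopen (D `&` D') /\ (D `&` D') x by split; [apply: clopenI | split].
  by exists (exist (fun D => clopen D /\ D x) _ DD) => z [[Dz Dz'] nz]; split; split.
- apply: contrapT => nE; apply: nK; exists D => z Dz; apply: contrapT => nz.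
  by apply: nE; exists z; split=> //; split.
have Qq : Q q by move=> D DP; have [] := Eq (exist _ D DP).
have [_ nq] := Eq (exist _ [set: T] (conj clopenT Logic.I)).
have nOq : ~ O q by move=> Oq; apply: nq; left.
have Vq : closure V q by apply: contrapT => nVq; apply: nq; right.
by case: (VQB q Vq); split=> // /BO.
Qed.
End Compactness.

(* Values in the concrete groups {perm 'I_k}, rather than in an arbitrary finite
   group, keep this type in a universe small enough to index filters. *)
Record finquo (G : topGroupType) := FinQuo {
  fq_degree : nat;
  fq_group : {group {perm 'I_fq_degree}};
  fq_map :> G -> {perm 'I_fq_degree};
  fqM : {morph fq_map : x y / x * y};
  fq_ker_nbhs : nbhs (1 : G) [set g | fq_map g = 1];
  fq_imP : forall y, y \in fq_group <-> exists g, fq_map g = y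
}.

Definition fq_type (G : topGroupType) (q : finquo G) : finGroupType :=
  {perm 'I_(fq_degree q)}.

(** * Existence of arbitrarily fine finite quotients *)

Section FiniteQuotients.
Variable G : topGroupType.
Implicit Types (q r : finquo G) (H A : set G).

Lemma mull_continuous (a : G) : continuous (fun x : G => a * x).
Proof.
move=> x; apply: (@continuous_comp _ _ _ (fun x : G => (a, x))
  (fun p : G * G => p.1 * p.2)); last exact: mulg_continuous.
by apply: cvg_pair; [exact: cvg_cst | exact: cvg_id].
Qed.

Lemma mulr_continuous (a : G) : continuous (fun x : G => x * a).
Proof.
move=> x; apply: (@continuous_comp _ _ _ (fun x : G => (x, a))
  (fun p : G * G => p.1 * p.2)); last exact: mulg_continuous.
by apply: cvg_pair; [exact: cvg_id | exact: cvg_cst].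
Qed.

Lemma fq1 q : q 1 = 1.
Proof. by apply: (mulgI (q 1)); rewrite -fqM !mulg1. Qed.

Lemma fqV q : {morph q : x / x^-1}.
Proof. by move=> x; apply: (mulgI (q x)); rewrite -fqM !mulgV fq1. Qed.

Lemma fqX q n : {morph q : x / x ^+ n}.
Proof. by move=> x; elim: n => [|n IHn]; rewrite ?fq1 // !expgS fqM IHn. Qed.

Lemma fqR q : {morph q : x y / [~ x, y]}.
Proof. by move=> x y; rewrite !commgEl !conjgE !fqM !fqV. Qed.

Lemma fqJ q : {morph q : x y / x ^ y}.
Proof. by move=> x y; rewrite !conjgE !fqM !fqV. Qed.

Lemma fq_in q g : q g \in fq_group q.
Proof. by apply/fq_imP; exists g. Qed.

Lemma fq_fibre_nbhs q g : nbhs g [set h | q h = q g].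
Proof.
have : nbhs (g^-1 * g) [set h | q h = 1] by rewrite mulVg; apply: fq_ker_nbhs.
move=> n1; have n2 : nbhs g ((fun x => g^-1 * x) @^-1` [set h | q h = 1]).
  exact: mull_continuous n1.
apply: filterS n2 => h /= qh.
by apply: (mulgI (q g)^-1); rewrite -fqV -fqM qh fqV mulVg.
Qed.

Lemma fq_open q (A : set (fq_type q)) : open (q @^-1` A).
Proof.
rewrite openE => g Ag; apply: filterS (fq_fibre_nbhs q g) => h /= qh.
by rewrite /preimage /= qh.
Qed.

Lemma fq_closed q (A : set (fq_type q)) : closed (q @^-1` A).
Proof.
have -> : q @^-1` A = ~` (q @^-1` (~` A)).
  by rewrite preimage_setC setCK.
by apply: open_closedC; apply: fq_open.
Qed.

(* A compact neighbourhood of 1 that is open contains an open subgroup, namely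
   its right stabiliser; the finite quotient is the action on its cosets. *)
Lemma finquo_small : profinite [set: G] -> forall U : set G, nbhs 1 U ->
  exists q, forall g, q g = 1 -> U g.
Proof.
move=> [_ cG hG tG] U nU; have {}hG := hausdorff_set_typeT hG.
have zG := compact_zero_dimensional hG cG tG.
have [D [D1 [oD cD]] DU] := zero_dimensional_cvg hG zG cG nU.
pose W := [set h | forall u, D u -> D (u * h)].
(* Each u in the open set D has its own neighbourhood of 1; compactness of D makes one neighbourhood
   serve all u. *)
have nW : nbhs 1 W.
  have /compact_near_coveringP : compact D by apply: subclosed_compact cG _.
  move=> /(_ G (nbhs 1) (fun h u => D (u * h)) _); apply=> u Du.
  have : nbhs (u * 1) D by rewrite mulg1; apply: open_nbhs_nbhs.
  by move=> n1; have := @mulg_continuous G (u, 1) _ n1.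
pose H := [set h | W h /\ W h^-1].
have H1 : H 1 by split=> u; rewrite ?invg1 mulg1.
have HM x y : H x -> H y -> H (x * y).
  move=> [Wx WxV] [Wy WyV]; split=> u Du; first by rewrite mulgA; apply/Wy/Wx.
  by rewrite invMg mulgA; apply/WxV/WyV.
have HV x : H x -> H x^-1 by move=> [Wx WxV]; split; rewrite ?invgK.
have HU : H `<=` U by move=> h [Wh _]; apply: DU; rewrite -(mul1g h); apply: Wh.
have nH : nbhs 1 H.
  apply: filterI => //; move: nW; rewrite -{1}(@invg1 G).
  by move=> n1; have := @invg_continuous G 1 _ n1.
pose f (g : G) := [set x | H (x * g^-1)].
have nf g x : f g x -> nbhs x (f g).
  move=> Hxg; have nHxg : nbhs (x^-1 * x) H by rewrite mulVg.
  have nx := @mull_continuous x^-1 x _ nHxg.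
  have {nx} : nbhs (x * g^-1) [set y | H ((x * g^-1)^-1 * y)].
    by apply: mull_continuous; rewrite mulVg.
  move=> nx; have : nbhs x [set y | H ((x * g^-1)^-1 * (y * g^-1))].
    exact: (@mulr_continuous g^-1 x _ nx).
  apply: filterS => y /= /(HM _ _ Hxg); by rewrite mulgA mulgV mul1g.
(* By compactness finitely many cosets of the open subgroup H cover G; s may meet a coset several
   times. *)
have [s covs] : exists s : seq G, forall x, exists2 y, y \in s & H (x * y^-1).
  apply: contrapT => ncov.
  pose E (s : seq G) := \bigcap_(y in [set` s]) ~` f y.
  have [|||s|x _ Ex] := @compact_directed G (seq G) E [set: G] cG.
  - move=> s; apply: closed_bigI => y _; apply: open_closedC.
    by rewrite openE => x /nf.
  - by exists [::].
  - move=> s t; exists (s ++ t) => x Ex.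
    by split=> y /= ys; apply: Ex; rewrite /= mem_cat ys ?orbT.
  - apply: contrapT => nE; apply: ncov; exists s => x; apply: contrapT => nx.
    by apply: nE; exists x; split=> // y /= ys Hxy; apply: nx; exists y.
  by apply: (Ex [:: x] x); rewrite /= ?mem_seq1 // /f /= mulgV.
pose k := size s.
pose p x (y : G) := `[< H (x * y^-1) >].
have e_lt x : (find (p x) s < k)%N.
  rewrite -has_find; have [y sy Hxy] := covs x.
  by apply/hasP; exists y => //; apply/asboolP.
pose e x : 'I_k := Ordinal (e_lt x); pose r (i : 'I_k) := nth 1 s i.
have Hr x : H (x * (r (e x))^-1).
  by apply/asboolP/(@nth_find _ 1 (p x)); rewrite has_find.
have eH h x : H h -> e (h * x) = e x.
  move=> Hh; apply/val_inj => /=; apply: eq_find => y; apply/asboolP/asboolP.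
    by move=> /(HM _ _ (HV _ Hh)); rewrite -!mulgA mulKg.
  by rewrite -mulgA; apply: HM.
have er x y : H (x * y^-1) -> e x = e y.
  by move=> h; rewrite -(eH _ y h) mulgKV.
have re x y : e x = e y -> H (x * y^-1).
  move=> exy; have := HM _ _ (Hr x) (HV _ (Hr y)).
  by rewrite exy invMg invgK mulgA mulgKV.
have eK x : e (r (e x)) = e x by apply/esym/er.
(* One position per coset of H: that of the first entry of s in it. *)
pose T := {i : 'I_k | e (r i) == i}.
have eT x : e (r (e x)) == e x by rewrite eK.
pose v (i : 'I_#|{: T}|) : 'I_k := val (enum_val i).
have vK i : e (r (v i)) = v i by apply/eqP/(valP (enum_val i)).
have v_inj : injective v by move=> i j /val_inj/enum_val_inj.
pose act g (i : 'I_#|{: T}|) : 'I_#|{: T}| :=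
  enum_rank (exist _ (e (r (v i) * g)) (eT _) : T).
have vact g i : v (act g i) = e (r (v i) * g) by rewrite /v enum_rankK.
have act_inj g : injective (act g).
  move=> i j /(congr1 v); rewrite !vact => /re; rewrite invMg mulgA mulgK => /er.
  by rewrite !vK => /v_inj.
pose phi g : {perm 'I_#|{: T}|} := perm (@act_inj g).
have phiM : {morph phi : x y / x * y}.
  move=> x y; apply/permP=> i; rewrite permM !permE; apply/v_inj; rewrite !vact.
  apply: er; rewrite mulgA invMg !mulgA mulgK; exact: Hr.
(* An element acts trivially once it lies in finitely many conjugates of H, one for each
   representative. *)
have nker : nbhs (1 : G) [set g | phi g = 1].
  have : \forall g \near (1 : G), forall i : 'I_#|{: T}|,
      H (r (v i) * g * (r (v i))^-1).
    apply: filter_forall => i.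
    have : nbhs (r (v i) * 1) (f (r (v i))) by apply: nf; rewrite mulg1 /f /= mulgV.
    by move=> n1; have := @mull_continuous (r (v i)) 1 _ n1.
  apply: filterS => g Hg; apply/permP=> i; rewrite permE perm1; apply/v_inj.
  by rewrite vact (er _ _ (Hg i)) vK.
pose Im : {set {perm 'I_#|{: T}|}} := finset (fun y => `[< exists g, phi g = y >]).
have imP y : y \in Im <-> exists g, phi g = y by rewrite inE; split=> /asboolP.
have phi1 : phi 1 = 1 by apply: (mulgI (phi 1)); rewrite -phiM !mulg1.
have gIm : group_set Im.
  apply/group_setP; split; first by apply/imP; exists 1.
  by move=> _ _ /imP[x <-] /imP[y <-]; apply/imP; exists (x * y).
exists (@FinQuo G _ (Group gIm) phi phiM nker imP) => g /= phig.
(* The stabiliser of the coset H itself is H. *)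
apply: HU; pose i0 := enum_rank (exist _ (e 1) (eT 1) : T).
have v0 : v i0 = e 1 by rewrite /v enum_rankK.
have := congr1 (fun a : {perm _} => v (a i0)) phig.
rewrite permE perm1 vact v0 => /re; rewrite -mulgA => Hg.
have := HM _ _ (Hr 1) Hg.
by rewrite mul1g mulKg invg1 mulg1.
Qed.
End FiniteQuotients.

Section TopGenerated.
Variable G : topGroupType.
Implicit Types (A H : set G).

Lemma top_generated_closed_subgroup A : closed_subgroup (top_generated A).
Proof.
split; last by apply: closed_bigI => H [[_ ?] _].
split=> [H [[[]]] //|x y Ax Ay H HA|x Ax H HA].
  by have [[[_ HM _] _] _] := HA; apply: HM; [apply: Ax | apply: Ay].
by have [[[_ _ HV] _] _] := HA; apply: HV; apply: Ax.
Qed.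

Lemma sub_top_generated A : A `<=` top_generated A.
Proof. by move=> x Ax H [_]; apply. Qed.

Lemma top_generated_min A H :
  closed_subgroup H -> A `<=` H -> top_generated A `<=` H.
Proof. by move=> cH AH x; apply. Qed.

Lemma subgroupX H x n : subgroup H -> H x -> H (x ^+ n).
Proof.
by move=> [H1 HM _] Hx; elim: n => // n IHn; rewrite expgS; apply: HM.
Qed.
End TopGenerated.

(** * Assembling data from all finite quotients *)

Section Profinite.
Variable G : topGroupType.
Hypothesis profG : profinite [set: G].
Implicit Types (q r t : finquo G) (H A K : set G).
Local Notation D := (derived_subgroup G).

Definition refines t q : Prop := forall g, t g = 1 -> q g = 1.

Let hG : hausdorff_space G.
Proof. by case: profG => _ _ hT _; apply: hausdorff_set_typeT. Qed.

Let closed_compact K : closed K -> compact K.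
Proof. by case: profG => _ cG _ _ cK; apply: subclosed_compact cK cG _. Qed.

Lemma finquo_refine2 q r : exists t, refines t q /\ refines t r.
Proof.
have := finquo_small profG (filterI (fq_ker_nbhs q) (fq_ker_nbhs r)).
by case=> t tqr; exists t; split=> g /tqr[].
Qed.

Lemma finquo_refine_der t q n g : refines t q ->
  t g \in (fq_group t)^`(n) -> q g \in (fq_group q)^`(n).
Proof.
(* The map q factors through t: [f] chooses a preimage under t, and the default 1 is not reached on
   the image of t. *)
move=> tq; pose f y := q (xget 1 [set x | t x = y]).
have fE x : f (t x) = q x.
  have /= tx : [set x' | t x' = t x] (xget 1 [set x' | t x' = t x]).
    by apply: xgetPex; exists x.
  apply: (mulgI (q x)^-1); rewrite mulVg -fqV /f -fqM; apply: tq.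
  by rewrite fqM fqV tx mulVg.
have fM : {in fq_group t &, {morph f : x y / x * y}}.
  move=> _ _ /fq_imP[x <-] /fq_imP[y <-].
  by rewrite -fqM !fE fqM.
have im_f : (Morphism fM @* fq_group t)%g = fq_group q.
  apply/setP=> y; apply/idP/idP => [/morphimP[_ _ /fq_imP[g' <-] ->]|/fq_imP[g' <-]].
    by rewrite /= fE fq_in.
  by rewrite -fE; apply: (mem_morphim (Morphism fM)); apply: fq_in.
move=> tg; rewrite -im_f -morphim_der // -fE.
by apply: (mem_morphim (Morphism fM)); rewrite ?fq_in.
Qed.

(** Turns solutions found separately in each finite quotient into one solution in G, provided that
    solving in a finer quotient solves in a coarser one. *)
Lemma compact_finquo (E : finquo G -> set G) K :
    closed K -> (forall q, closed (E q)) ->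
    (forall t q, refines t q -> E t `<=` E q) ->
    (forall q, K `&` E q !=set0) ->
  exists2 x, K x & forall q, E q x.
Proof.
move=> cK cE monE KE; apply: compact_directed => //; first exact: closed_compact.
  have [q _] := finquo_small profG filterT; by exists q.
move=> q r; have [t [tq tr]] := finquo_refine2 q r; exists t => x Ex.
by split; apply: monE Ex.
Qed.

Lemma finquo_separates x y : (forall q, q x = q y) -> x = y.
Proof.
move=> qxy; apply: contrapT => neq_xy.
have nU : nbhs (1 : G) (~` [set x^-1 * y]).
  apply: open_nbhs_nbhs; split.
    apply: closed_openC; apply: accessible_closed_set1; exact: hausdorff_accessible.
  move=> /= h; apply: neq_xy; apply: (mulgI x^-1); rewrite mulVg; exact: h.
have [q qU] := finquo_small profG nU; apply: (qU (x^-1 * y)) => //.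
by rewrite fqM fqV qxy mulVg.
Qed.

Lemma closed_finquoP K x : closed K -> (forall q, exists2 y, K y & q y = q x) -> K x.
Proof.
move=> cK Kq; have [||q|y Ky yx] := @compact_finquo (fun q => [set y | q y = q x]) K cK.
- by move=> q; apply: (@fq_closed _ q [set q x]).
- move=> t q tq y /= txy; apply: (mulgI (q x)^-1); rewrite mulVg -fqV -fqM.
  by apply: tq; rewrite fqM fqV txy mulVg.
- by have [y Ky yx] := Kq q; exists y.
by rewrite -(finquo_separates yx).
Qed.

Lemma fq_preim_closed_subgroup q (B : {group fq_type q}) :
  closed_subgroup [set x | q x \in B].
Proof.
split; last exact: (@fq_closed _ q [set y | y \in B]).
split=> [|x y|x] /=; rewrite ?fq1 ?fqM ?fqV ?groupV ?group1 //.
exact: groupM.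
Qed.

Lemma fq_der_sub q x : D x -> q x \in (fq_group q)^`(1).
Proof.
apply: (top_generated_min (fq_preim_closed_subgroup _)) => _ [a [b ->]] /=.
by rewrite fqR mem_commg ?fq_in.
Qed.

Lemma fq_der_lift q y : y \in (fq_group q)^`(1) -> exists2 x, D x & q x = y.
Proof.
pose B : {set fq_type q} := finset (fun y => `[< exists2 x, D x & q x = y >]).
have BP z : z \in B <-> exists2 x, D x & q x = z by rewrite inE; split=> /asboolP.
have [[D1 DM _] _] := top_generated_closed_subgroup (@commutators G).
have gB : group_set B.
  apply/group_setP; split; first by apply/BP; exists 1; rewrite ?fq1.
  move=> _ _ /BP[x Dx <-] /BP[z Dz <-]; apply/BP.
  by exists (x * z); [apply: DM | rewrite fqM].
suff /fintype.subsetP sB : (fq_group q)^`(1) \subset Group gB by move/sB/BP.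
rewrite gen_subG; apply/fintype.subsetP=> z.
case/imset2P=> _ _ /fq_imP[a <-] /fq_imP[b <-] ->.
apply/BP; exists [~ a, b]; last exact: fqR.
by apply: sub_top_generated; exists a, b.
Qed.

Lemma derived_finquoP x : (forall q, q x \in (fq_group q)^`(1)) -> D x.
Proof.
move=> qx; apply: closed_finquoP => [|q]; last exact: fq_der_lift (qx q).
exact: (top_generated_closed_subgroup (@commutators G)).2.
Qed.

(** Quantifying over all finite quotients, with no choice among them, is what makes it invariant
    under automorphisms. *)
Definition torsion_kernel n : set G :=
  [set x | forall q, q x \in torsion_set (fq_group q) n].

Lemma torsion_kernel_closed_subgroup n : closed_subgroup (torsion_kernel n).
Proof.
have cq q := @fq_preim_closed_subgroup q (Group (torsion_group_set (fq_group q) n)).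
split.
  split=> [q|x y Mx My q|x Mx q].
  - by have [[] ] := cq q.
  - by have [[_ qM _] _] := cq q; apply: qM; [apply: Mx | apply: My].
  - by have [[_ _ qV] _] := cq q; apply: qV; apply: Mx.
have -> : torsion_kernel n = \bigcap_(q in [set: finquo G])
    [set x | q x \in torsion_set (fq_group q) n].
  by apply/seteqP; split=> x Mx q; [move=> _ |]; apply: Mx.
by apply: closed_bigI => q _; have [] := cq q.
Qed.

Lemma torsion_kernelJ n x g : torsion_kernel n x -> torsion_kernel n (x ^ g).
Proof. by move=> Mx q; rewrite fqJ; exact: torsionJ (Mx q) (fq_in _ _). Qed.

Lemma torsion_kernel_der n : torsion_kernel n `<=` D.
Proof.
move=> x Mx; apply: derived_finquoP => q.
by have := Mx q; rewrite inE => /andP[].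
Qed.
End Profinite.

(** * The finite characteristic subgroup *)

Definition order_bound m :=
  (second_derived_bound m * (m`! * m`!) ^ (m * (m`! * m`!)))%N.

Section Cover.
Variables (m : nat) (G : topGroupType) (C : 'I_m -> set G).
Hypotheses (profG : profinite [set: G]) (procC : forall i, procyclic (C i)).
Hypothesis covC : forall x y : G, exists i, C i [~ x, y].
Implicit Types (q r t : finquo G) (H A K : set G).
Local Notation D := (derived_subgroup G).
Local Notation n := (m`! * m`!)%N.
Local Notation M := (@torsion_kernel G n).

Lemma finquo_cover q : exists c, comm_cover (fq_group q) (c : 'I_m -> fq_type q).
Proof.
have /choice[g gC] : forall i, exists g, C i = top_generated [set g].
  by move=> i; have [_] := procC i.
exists (fun i => q (g i)); split=> [i|_ _ /fq_imP[x <-] /fq_imP[y <-]].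
  exact: fq_in.
have [i Ci] := covC x y; exists i; rewrite -fqR.
move: Ci; rewrite gC; apply: (top_generated_min (fq_preim_closed_subgroup _)).
by move=> _ ->; apply: cycle_id.
Qed.

(** A single finite quotient separates the finitely many entries of s, and their images lie in its
    torsion subgroup, of bounded order. *)
Lemma torsion_kernel_size (s : seq G) :
  uniq s -> (forall x, x \in s -> M x) -> (size s <= order_bound m)%N.
Proof.
move=> us sM.
pose P := [set z | exists x y, [/\ x \in s, y \in s, x != y & z = x^-1 * y]].
have finP : finite_set P.
  apply: (@sub_finite_set _ _ [set` [seq x^-1 * y | x <- s, y <- s]]).
    by move=> _ [x [y [xs ys _ ->]]] /=; apply: allpairs_f.
  exact: finite_seq.
have hG : hausdorff_space G by case: profG => _ _ hT _; apply: hausdorff_set_typeT.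
have nP : nbhs (1 : G) (~` P).
  apply: open_nbhs_nbhs; split.
    apply: closed_openC; move/hausdorff_accessible/accessible_finite_set_closed: hG.
    exact.
  move=> /= [x [y [_ _ + h]]]; apply/negP; rewrite negbK; apply/eqP.
  by apply: (mulgI x^-1); rewrite mulVg.
have [q qP] := finquo_small profG nP.
have inj : {in s &, injective q}.
  move=> x y xs ys qxy; apply/eqP; apply: contrapT => /negP nxy.
  by apply: (qP (x^-1 * y)); [rewrite fqM fqV qxy mulVg | exists x, y].
have um : uniq (map q s) by rewrite map_inj_in_uniq.
have [c cov] := finquo_cover q.
have n_gt0 : (0 < n)%N by rewrite muln_gt0 fact_gt0.
rewrite -(size_map q); apply: (@leq_trans #|torsion_set (fq_group q) n|); last first.
  apply: leq_trans (card_torsion cov n_gt0) _.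
  by rewrite leq_mul // (card_der2 cov).
rewrite cardE; apply: uniq_leq_size um _ => _ /mapP[x xs ->].
by rewrite mem_enum; apply: sM.
Qed.

(** Duplicate-free lists in M have bounded length, so a longest one exhausts M. *)
Lemma torsion_kernel_seq : exists s : seq G,
  [/\ uniq s, (size s <= order_bound m)%N & forall x, M x <-> x \in s].
Proof.
pose P k := `[< exists s : seq G,
  [/\ uniq s, size s = k & forall x, x \in s -> M x] >].
have exP : exists k, P k by exists 0%N; apply/asboolP; exists [::].
have leP k : P k -> (k <= order_bound m)%N.
  by move=> /asboolP[s [us <- sM]]; apply: torsion_kernel_size.
have [k /asboolP[s [us sk sM]] maxk] := ex_maxnP exP leP.
exists s; split=> //; first exact: torsion_kernel_size.
move=> x; split=> [Mx|]; last exact: sM.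
apply/negPn/negP => xs; suff /maxk : P k.+1 by rewrite ltnn.
apply/asboolP; exists (x :: s); split; rewrite /= ?xs ?sk // => y.
by rewrite inE => /predU1P[->//|/sM].
Qed.

(** The composite of q with [phi] is again a finite quotient with the same image, and M satisfies
    its condition there. *)
Lemma torsion_kernel_automorphism phi x :
  continuous_automorphism phi -> M x -> M (phi x).
Proof.
move=> [[psi phiK psiK] phiM phi_cont] Mx q.
have phi1 : phi 1 = 1 by apply: (mulgI (phi 1)); rewrite -phiM !mulg1.
have qphiM : {morph (q \o phi) : x y / x * y} by move=> a b /=; rewrite phiM fqM.
have qphi_ker : nbhs (1 : G) [set g | (q \o phi) g = 1].
  have nq : nbhs (phi 1) [set g | q g = 1] by rewrite phi1; apply: fq_ker_nbhs.
  exact: (phi_cont 1 _ nq).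
have qphi_im y : y \in fq_group q <-> exists g, (q \o phi) g = y.
  split=> [/fq_imP[g <-]|[g <-]]; last exact: fq_in.
  by exists (psi g); rewrite /= psiK.
exact: Mx (FinQuo qphiM qphi_ker qphi_im).
Qed.

Lemma torsion_kernel_characteristic : characteristic M.
Proof.
split; first exact: torsion_kernel_closed_subgroup.
move=> phi aut; have [s [us _ sP]] := torsion_kernel_seq.
have [[psi phiK psiK] _ _] := aut.
(* An injective map of the finite set M into itself is onto. *)
have phis : {subset map phi s <= s}.
  by move=> _ /mapP[x /sP Mx ->]; apply/sP/torsion_kernel_automorphism.
have um : uniq (map phi s) by rewrite map_inj_uniq //; apply: can_inj phiK.
have [_ eq_s] : (size (map phi s) = size s) * (map phi s =i s).
  by apply: uniq_min_size um phis _; rewrite size_map.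
apply/seteqP; split=> [_ [x Mx <-]|y /sP].
  exact: torsion_kernel_automorphism.
by rewrite -eq_s => /mapP[x /sP Mx ->]; exists x.
Qed.

Definition torsion_normal : normalSubgroup G :=
  @NormalSubgroup G M (torsion_kernel_closed_subgroup _ n).1 (@torsion_kernelJ G n).
Local Notation N := torsion_normal.

Lemma closed_derived : closed D.
Proof. exact: (top_generated_closed_subgroup (@commutators G)).2. Qed.

(** Generators exist in each finite quotient by [der1_procyclic_mod], lift to G', and remain
    generators in coarser quotients, so compactness gives a common one. *)
Lemma exists_generator : exists2 g, D g &
  forall q y, y \in (fq_group q)^`(1) ->
    exists j : nat, (q g ^+ n ^+ j)^-1 * y ^+ n \in (fq_group q)^`(2).
Proof.
pose A q := [set a : fq_type q | forall y, y \in (fq_group q)^`(1) ->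
  exists j : nat, (a ^+ n ^+ j)^-1 * y ^+ n \in (fq_group q)^`(2)].
have [|t q tq g Ag y Dy|q|g Dg Ag] :=
    @compact_finquo G profG (fun q => q @^-1` A q) D closed_derived.
- by move=> q; apply: fq_closed.
- have [x Dx xy] := fq_der_lift Dy; have [j tj] := Ag _ (fq_der_sub t Dx).
  exists j; rewrite -xy -!fqX -fqV -fqM; apply: (finquo_refine_der tq).
  by rewrite fqM fqV !fqX.
- have [c cov] := finquo_cover q; have [d Dd dP] := der1_procyclic_mod cov.
  by have [g Dg gd] := fq_der_lift Dd; exists g; split=> //; rewrite /preimage /= gd.
by exists g.
Qed.

(** In each finite quotient a power of g serves as h, by [torsion_div]; compactness of the closed
    subgroup generated by g supplies one h for all. *)
Lemma derived_generated g : D g ->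
    (forall q y, y \in (fq_group q)^`(1) ->
      exists j : nat, (q g ^+ n ^+ j)^-1 * y ^+ n \in (fq_group q)^`(2)) ->
  forall x, D x -> exists2 h, top_generated [set g] h & M (h^-1 * x).
Proof.
move=> Dg gP x Dx; have [sK cK] := top_generated_closed_subgroup [set g].
pose A q := [set a : fq_type q | a^-1 * q x \in torsion_set (fq_group q) n].
have [|t q tq h Ah|q|h Kh Ah] :=
    @compact_finquo G profG (fun q => q @^-1` A q) (top_generated [set g]) cK.
- by move=> q; apply: fq_closed.
- move: Ah; rewrite /preimage /A /= -!fqV -!fqM !inE -!fqX => /andP[h1 h2].
  by rewrite (finquo_refine_der (n := 1) tq) ?(finquo_refine_der (n := 2) tq).
- have [j gj] := gP q (q x) (fq_der_sub q Dx); exists (g ^+ j); split.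
    by apply: (subgroupX _ sK); apply: sub_top_generated.
  rewrite /preimage /A /= fqX.
  by apply: torsion_div gj; apply: fq_der_sub.
by exists h => // q; rewrite fqM fqV; apply: Ah.
Qed.

(** * Procyclicity of G'/M *)

Local Notation Q := (quotient_group N).

(** Some finite quotient shows that x^-1 y is not in M. The coset of x modulo the preimage of its
    torsion subgroup is clopen and a union of cosets of M, so its image and that of its complement
    are open and disjoint. *)
Lemma quotient_separated (a b : Q) : a != b ->
  exists U : set Q, [/\ clopen U, U a & ~ U b].
Proof.
rewrite -[a]quo_reprK -[b]quo_reprK.
set x := generic_quotient.repr a; set y := generic_quotient.repr b => neq_ab.
have [q qxy] : exists q, q (x^-1 * y) \notin torsion_set (fq_group q) n.
  apply: contrapT => nq; move/eqP: neq_ab; apply; apply/quoP => q.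
  by apply/negPn/negP => h; apply: nq; exists q.
pose A := [set z | z \in torsion_set (fq_group q) n].
pose V := (fun z : G => x^-1 * z) @^-1` (q @^-1` A).
have oV B : open ((fun z : G => x^-1 * z) @^-1` (q @^-1` B)).
  by apply: open_comp => [z _|]; [apply: mull_continuous | apply: fq_open].
have satV z z' : V z -> quo N z = quo N z' -> V z'.
  rewrite /V /preimage /A /= => Vz /quoP/(_ q) zz'.
  have -> : x^-1 * z' = (x^-1 * z) * (z^-1 * z') by rewrite mulgA mulgK.
  by rewrite fqM; apply: (@groupM _ (Group (torsion_group_set (fq_group q) n))).
exists (quo N @` V); split.
- split; first by apply: quo_open; apply: oV.
  have -> : quo N @` V = ~` (quo N @` ~` V).
    apply/seteqP; split=> [_ [z Vz <-] [z' nVz' zz']|c].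
      by apply: nVz'; apply: satV Vz _.
    rewrite -[c]quo_reprK => nc; exists (generic_quotient.repr c) => //.
    apply: contrapT => nV.
    by apply: nc; exists (generic_quotient.repr c).
  by apply: open_closedC; apply: quo_open; exact: (oV (~` A)).
- exists x => //; rewrite /V /preimage /A /= mulVg fq1.
  exact: (group1 (Group (torsion_group_set (fq_group q) n))).
- move=> [z Vz zy]; have := satV _ _ Vz zy; rewrite /V /preimage /A /=.
  exact/negP.
Qed.

Lemma quotient_derived_procyclic : procyclic (quotient_subgroup D N).
Proof.
set S := quotient_subgroup D N.
have [[D1 DM DV] _] := top_generated_closed_subgroup (@commutators G).
have subS : subgroup S.
  split; first by exists 1.
    move=> _ _ [x Dx <-] [y Dy <-]; exists (x * y); first exact: DM.
    exact: quo_morphM.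
  by move=> _ [x Dx <-]; exists x^-1; [apply: DV | apply: quo_morphV].
have cS : compact S.
  apply: continuous_compact; first by apply: continuous_subspaceT; apply: quo_continuous.
  by case: profG => _ cG _ _; apply: subclosed_compact closed_derived cG _.
have hQ : hausdorff_space Q.
  apply: hausdorff_set_typeT; apply: hausdorff_set_type => a b _ _.
  exact: quotient_separated.
split.
  split=> //.
    by apply: hausdorff_set_type => a b _ _; apply: quotient_separated.
  by apply: separated_totally_disconnected => a b _ _; apply: quotient_separated.
have [g Dg gP] := exists_generator; exists (quo N g).
apply/seteqP; split; last first.
  apply: top_generated_min; last by move=> _ ->; exists g.
  by split=> //; apply: compact_closed.
move=> _ [x Dx <-]; have [[T1 TM TV] cT] := top_generated_closed_subgroup [set quo N g].
set T := top_generated [set quo N g] in T1 TM TV cT *.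
have [h Kh Mhx] := derived_generated Dg gP Dx.
have -> : quo N x = quo N h by apply/esym/quoP.
(* The preimage of T is a closed subgroup containing g, hence contains h. *)
have : (quo N @^-1` T) h; last by [].
apply: (top_generated_min _ _ Kh); last by move=> _ ->; apply: sub_top_generated.
split; last by apply: preimage_closed cT => z _; apply: quo_continuous.
split=> [|a b Ta Tb|a Ta].
- exact: T1.
- by have := TM _ _ Ta Tb; rewrite /preimage /= quo_morphM.
- by have := TV _ Ta; rewrite /preimage /= quo_morphV.
Qed.
End Cover.

Theorem theoremA :
  exists f : nat -> nat,
    forall (m : nat) (G : topGroupType) (C : 'I_m -> set G),
      (0 < m)%N ->
      profinite [set: G] ->
      (forall i : 'I_m, procyclic (C i)) ->
      (forall x y : G, exists i : 'I_m, C i [~ x, y]%g) ->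
      exists M : normalSubgroup G,
        [/\ characteristic M,
            M `<=` derived_subgroup G,
            finite_set M,
            (M #<= `I_(f m))%card
          & procyclic (quotient_subgroup (derived_subgroup G) M)].
Proof.
exists order_bound => m G C _ profG procC covC.
have [s [us les sP]] := torsion_kernel_seq profG procC covC.
have sE : torsion_kernel (G := G) (m`! * m`!) = [set` s].
  by apply/seteqP; split=> x /sP.
exists (torsion_normal m G); split.
- exact: (torsion_kernel_characteristic profG procC covC).
- exact: torsion_kernel_der.
- by rewrite /torsion_normal /= sE; apply: finite_seq.
- rewrite /torsion_normal /= sE.
  (* Positions in s index M; the default 1 is not reached, as i < size s. *)
  have -> : [set` s] = nth 1 s @` `I_(size s).
    apply/seteqP; split=> [x /= xs|_ [i /= lt_i <-]]; last exact: mem_nth.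
    by exists (index x s); rewrite /= ?index_mem ?nth_index.
  apply: card_le_trans (card_image_le _ _) _.
  by apply: subset_card_le => i /= lt_i; apply: leq_trans lt_i les.
- exact: (quotient_derived_procyclic profG procC covC).
Qed.
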